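(* Let $d=2$, $\Gamma=[0,1]^2$, $\alpha\in(0,\infty)$, $\eta\in(0,1]$. Suppose that $\phi_n \in\Phi_{2,\eta} \cap\Psi_2$ for all $n$, and set $p_n:=\mu(\phi_n)$, $r_n:=\rho_\eta(\phi_n)$, with $r_n=n^{-\Omega(1)}$. Suppose $p_n = \Theta(n^{-1/3} (\log n)^{-1})$ and $$n I(\phi_n) = 4 \Bigl( \log(1/p_n) - \log\log(1/p_n) + \log\bigl(J_2(\phi_n)/(\beta_n J_1(\phi_n)^2)\bigr) \Bigr) +o(1)$$ as $n \to\infty$, with $\beta_n$ denoting the solution in $(0,\infty)$ to $$\bigl(3 J_2(\phi_n)\bigr)^{-3/2} J_1(\phi_n)^{3} \bigl(n^{1/3} p_n \log n\bigr)^{3/2} \beta_n^2 + \beta_n = \alpha.$$ Then, as $n\to\infty$, $$n \int_{\Gamma} \exp \Bigl(- n \int_\Gamma \phi_n(y-x) \,dy \Bigr) \,dx \to\alpha .$$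
   Context: $|\cdot|$ is the Euclidean norm on $\mathbb{R}^2$. A connection function on $\mathbb{R}^2$ is a measurable $\phi:\mathbb{R}^2\to[0,1]$ with $\phi(x)=\phi(-x)$ for all $x$. Put $\mu(\phi)=\sup_{x}\phi(x)$ and $\rho_\eta(\phi)=\inf\{|x|: x\in\mathbb{R}^2,\ \phi(x)<\eta\mu(\phi)\}$. $\Psi_2$ is the class of connection functions on $\mathbb{R}^2$ with $\phi(x)\ge\phi(y)$ whenever $|x|\le|y|$. $\Phi_{2,\eta}$ is the class of connection functions $\phi$ on $\mathbb{R}^2$ with $\rho_\eta(\phi)\in(0,\infty)$ and $\phi(x)\le 3\eta^{-1}\mu(\phi)\exp(-\eta(|x|/\rho_\eta(\phi))^\eta)$ for all $x$. Define $$I(\phi)=\int_{\mathbb{R}^2}\phi(x)\,dx,$$ $$J_1(\phi)=\mu(\phi)^{-1}\int_0^\infty\phi\bigl((\rho_\eta(\phi)t,0)\bigr)\,dt,\qquad J_2(\phi)=\mu(\phi)^{-1}\int_0^\infty\phi\bigl((\rho_\eta(\phi)t,0)\bigr)\,2\pi t\,dt .$$ $r_n=n^{-\Omega(1)}$ means that there is a constant $c>0$ with $r_n\le n^{-c}$ for all large $n$; $\Theta$ denotes equality of order up to positive constant factors. *)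

(* Defs.v *)
From HB Require Import structures.
From mathcomp Require Import all_boot all_order all_algebra.
From mathcomp Require Import all_classical all_reals all_analysis.

Set Implicit Arguments.
Unset Strict Implicit.
Unset Printing Implicit Defensive.

Import Order.TTheory GRing.Theory Num.Theory.
Import numFieldNormedType.Exports.

Local Open Scope classical_set_scope.
Local Open Scope ring_scope.

(* The canonical norm of the library on R * R is the sup norm, hence an
   explicit Euclidean norm. *)
Definition enorm2 (R : realType) (x : R * R) : R :=
  Num.sqrt (x.1 ^+ 2 + x.2 ^+ 2).

Definition leb2 (R : realType) :=
  ((@lebesgue_measure R) \x (@lebesgue_measure R))%E.

Definition unit_square (R : realType) : set (R * R) :=
  (`[0, 1] `*` `[0, 1])%classic.

Definition connection_function (R : realType) (phi : R * R -> R) : Prop :=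
  [/\ measurable_fun setT phi,
      forall x, 0 <= phi x <= 1
    & forall x, phi x = phi (- x)].

Definition conn_mu (R : realType) (phi : R * R -> R) : R := sup (range phi).

(* Extended-real valued, so that the infimum of the empty set is +oo. *)
Definition conn_rho_ext (R : realType) (eta : R) (phi : R * R -> R) : \bar R :=
  ereal_inf [set (enorm2 x)%:E | x in [set x | phi x < eta * conn_mu phi]].

Definition conn_rho (R : realType) (eta : R) (phi : R * R -> R) : R :=
  fine (conn_rho_ext eta phi).

Definition Psi2 (R : realType) (phi : R * R -> R) : Prop :=
  connection_function phi /\
  forall x y, enorm2 x <= enorm2 y -> phi y <= phi x.

Definition Phi2 (R : realType) (eta : R) (phi : R * R -> R) : Prop :=
  [/\ connection_function phi,
      (0 < conn_rho_ext eta phi < +oo)%E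
    & forall x, phi x <= 3 * eta^-1 * conn_mu phi *
        expR (- (eta * (enorm2 x / conn_rho eta phi) `^ eta))].

(* On Phi2, the three integrals below are finite, so Rintegral loses nothing. *)
Definition conn_I (R : realType) (phi : R * R -> R) : R :=
  (\int[@leb2 R]_(x in setT) phi x)%R.

Definition conn_J1 (R : realType) (eta : R) (phi : R * R -> R) : R :=
  (conn_mu phi)^-1 *
  \int[@lebesgue_measure R]_(t in `[0, +oo[) phi (conn_rho eta phi * t, 0).

Definition conn_J2 (R : realType) (eta : R) (phi : R * R -> R) : R :=
  (conn_mu phi)^-1 *
  \int[@lebesgue_measure R]_(t in `[0, +oo[)
    (phi (conn_rho eta phi * t, 0) * (2 * pi * t)).

(* u_n = n^(-Omega(1)) *)
Definition npow_neg_Omega1 (R : realType) (u : nat -> R) : Prop :=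
  exists2 c : R, 0 < c & \forall n \near \oo, u n <= n%:R `^ (- c).

Definition is_Theta (R : realType) (u v : nat -> R) : Prop :=
  exists c1 c2 : R, [/\ 0 < c1, 0 < c2
    & \forall n \near \oo, c1 * v n <= u n <= c2 * v n].

(* Main.v *)
(** Seen from a point at scaled distances [s = a / r] and [t = b / r] from two
    sides, the expected degree [n \int_Gamma phi] is
    [lam (J2 / 4 + A s + A t + B s t)] up to a negligible tail, where
    [lam = n p r^2] is of order [log n], [B] is the integral of the profile over
    the box [0, s] x [0, t], and [A s = B s +oo] equals [J1 s] up to [s^2], by
    monotonicity alone.  Laplace's method then gives a corner contribution
    [4 exp (- nI / 4) / (n (p r J1)^2)] and an edge contribution
    [2 exp (- nI / 2) / (p r J1)], the interior being negligible since
    [nI ~ (4 / 3) log n].  Inserting the asymptotics of [nI], the logarithms of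
    these two quantities differ by [o(1)] from those of [beta_n] and of the
    quadratic term of the equation defining [beta_n], whose sum is [alpha]. *)

Require Import Defs.
From HB Require Import structures.
From mathcomp Require Import all_boot all_order all_algebra.
From mathcomp Require Import all_classical all_reals all_analysis.
From mathcomp Require Import measurable_realfun ring lra.

Set Implicit Arguments.
Unset Strict Implicit.
Unset Printing Implicit Defensive.

Import Order.TTheory GRing.Theory Num.Theory.
Import numFieldNormedType.Exports.

Local Open Scope classical_set_scope.
Local Open Scope ring_scope.

(** Uniformity in [n] comes from the fixed [eta]: it bounds [J1] and [J2] between positive constants
    and gives the decay [C * p * (1 + |z| / r) ^- 6] with [C] depending on [eta] alone, so no limit
    profile is needed. For each single [n] the integral is enclosed between two explicit expressions
    with free cutoffs [eps] and [T]. Up to [delta = eps * eta * r] the linearisation of [A] has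
    relative error [eps]; past [T] the connection function is given up, at the cost [tau]. The
    cutoffs face opposite demands. [eps] must tend to 0, while [eps * lam] must grow fast enough for
    [exp (- k * eps * lam)], [k > 0], to beat powers of [lam]. [T / r] must exceed the order of
    [sqrt lam], to make [n * tau] vanish, yet stay polynomial in [lam], because the points within
    [T] of two sides but off the corner are damped only by that exponential. The sequence [beta]
    need not converge, so the corner and edge terms have no separate limits. Each is compared with
    its share of [alpha] through a ratio tending to 1. *)

(** * Affine substitutions for Lebesgue measure on the line *)

Section affine.
Context {R : realType}.
Local Notation mu := (@lebesgue_measure R).
Local Open Scope ereal_scope.

Lemma measurable_affine (c d : R) :
  measurable_fun [set: R] (fun x : R => c * x + d : measurableTypeR R)%R.
Proof. by apply: measurable_funD => //; exact: measurable_realfun.measurable_funM. Qed.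

Lemma preimage_affine_itv (c d : R) (b1 b2 : bool) (x y : R) : (0 < c)%R ->
  (fun t => c * t + d)%R @^-1` [set` Interval (BSide b1 x) (BSide b2 y)] =
  [set` Interval (BSide b1 ((x - d) / c)) (BSide b2 ((y - d) / c))]%R.
Proof.
move=> c0; apply/seteqP; split => t /=; rewrite !in_itv/=;
  by case: b1; case: b2 => /=; rewrite ?ler_pdivrMr ?ltr_pdivrMr ?ler_pdivlMr
    ?ltr_pdivlMr// [(t * c)%R]mulrC ?lerBlDr ?lerBrDr ?ltrBlDr ?ltrBrDr.
Qed.

Lemma preimage_affine_itvy (c d : R) (b1 : bool) (x : R) : (0 < c)%R ->
  (fun t => c * t + d)%R @^-1` [set` Interval (BSide b1 x) +oo%O] =
  [set` Interval (BSide b1 ((x - d) / c)) +oo%O]%R.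
Proof.
move=> c0; apply/seteqP; split => t /=; rewrite !in_itv/=;
  by case: b1 => /=; rewrite ?ler_pdivrMr ?ltr_pdivrMr
    // [(t * c)%R]mulrC ?lerBlDr ?lerBrDr ?ltrBlDr ?ltrBrDr.
Qed.

(** Lebesgue measure is determined by its values on the intervals []a, b]], so the scaled
    pushforward has to be computed only there. *)
Lemma lebesgue_measure_affine (c d : R) (c0 : (0 < c)%R) (A : set R) :
  measurable A ->
  mu A = pushforward (mscale (NngNum (ltW c0)) mu)
    ((fun x => c * x + d)%R : R -> measurableTypeR R) A.
Proof.
apply: lebesgue_measure_unique; first exact: measurable_affine.
move=> maff _ [[a b]] _ <-.
transitivity (mscale (NngNum (ltW c0)) mu
  ((fun x => c * x + d)%R @^-1` `]a, b]%classic)); last by [].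
rewrite preimage_affine_itv// /mscale/= !lebesgue_measure_itv/=.
rewrite !lte_fin ltr_pM2r ?invr_gt0// ltrD2r; case: ifPn => [ab|_]; last by rewrite mule0.
by rewrite -!EFinD -EFinM; congr EFin; field; rewrite gt_eqF.
Qed.

Lemma ge0_integral_affine (c d : R) (E : set R) (f : R -> \bar R) :
  (0 < c)%R -> measurable E -> measurable_fun [set: R] f ->
  (forall x, 0 <= f x) ->
  \int[mu]_(x in E) f x =
  c%:E * \int[mu]_(x in (fun x => c * x + d)%R @^-1` E) f (c * x + d)%R.
Proof.
move=> c0 mE mf f0.
have maff := measurable_affine c d.
have mE' : measurable ((fun x => c * x + d)%R @^-1` E).
  by rewrite -[X in measurable X]setTI; exact: maff.
rewrite -[c%:E]/((NngNum (ltW c0))%:num%:E).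
rewrite -ge0_integral_mscale//; last first.
  by apply: measurable_funTS; exact: measurableT_comp.
transitivity (\int[pushforward (mscale (NngNum (ltW c0)) mu)
    ((fun x => c * x + d)%R : R -> measurableTypeR R)]_(x in E) f x); last first.
  have := @ge0_integral_pushforward _ _ (measurableTypeR R) (measurableTypeR R) R
    _ maff (mscale (NngNum (ltW c0)) mu) E f mE.
  by apply => //; exact: measurable_funTS.
by apply: eq_measure_integral => //= A mA _; exact: lebesgue_measure_affine.
Qed.
End affine.

(** * Splitting, reflecting and rescaling integrals on the line *)

Section one_dimensional_integrals.
Context {R : realType}.
Local Notation mu := (@lebesgue_measure R).
Local Open Scope ereal_scope.

Lemma ge0_integral_reflect (E : set R) (f : R -> \bar R) :
  measurable E -> measurable_fun [set: R] f -> (forall x, 0 <= f x) ->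
  \int[mu]_(x in E) f x = \int[mu]_(x in -%R @^-1` E) f (- x)%R.
Proof.
move=> mE mf f0.
have mopp : measurable_fun [set: measurableTypeR R]
    (-%R : measurableTypeR R -> measurableTypeR R) by [].
have := @ge0_integral_pushforward _ _ (measurableTypeR R) (measurableTypeR R) R
    _ mopp mu E f mE.
move=> <- //; last exact: measurable_funTS.
by apply: eq_measure_integral => //= A mA AS; exact/esym/lebesgue_measureN.
Qed.

Lemma ge0_integral_itv_split (b0 b2 : itv_bound R) (x : R) (f : R -> \bar R) :
  (b0 <= BRight x)%O -> (BLeft x <= b2)%O -> measurable_fun [set: R] f ->
  (forall x, 0 <= f x) ->
  \int[mu]_(t in [set` Interval b0 b2]) f t =
  \int[mu]_(t in [set` Interval b0 (BRight x)]) f t +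
  \int[mu]_(t in [set` Interval (BLeft x) b2]) f t.
Proof.
move=> b0x xb2 mf f0.
have [b0x'|] := leP b0 (BLeft x); last first.
  move=> xb0.
  have -> : b0 = BRight x.
    apply/le_anti; rewrite b0x/=.
    by case: b0 xb0 {b0x} => [[]y|[]]//=; rewrite !bnd_simp // => /ltW.
  rewrite [X in _ = X + _](_ : _ = 0) ?add0e.
    by rewrite integral_itv_obnd_cbnd//; exact: measurable_funTS.
  by rewrite set_itv_ge ?integral_set0// ltxx.
rewrite -[X in _ = X + _]integral_itv_bndo_bndc; last exact: measurable_funTS.
rewrite -ge0_integral_setU//.
- by rewrite -itv_bndbnd_setU.
- exact: measurable_funTS.
- apply/disj_setPS => t /= []; rewrite !itv_boundlr => /andP[_ h1] /andP[h2 _].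
  by have := le_trans h1 h2; rewrite bnd_simp ltxx.
Qed.

(** Seen from [a], the unit interval is [[- a, 1 - a]], and evenness reflects its negative part. *)
Lemma ge0_integral_even_shift (a : R) (f : R -> \bar R) :
  (0 <= a <= 1)%R -> measurable_fun [set: R] f ->
  (forall x, 0 <= f x) -> (forall x, f (- x)%R = f x) ->
  \int[mu]_(y in `[0%R, 1%R]) f (y - a)%R =
  \int[mu]_(y in `[0%R, a]) f y + \int[mu]_(y in `[0%R, (1 - a)%R]) f y.
Proof.
move=> /andP[a0 a1] mf f0 fe.
have E := @ge0_integral_affine R 1 (- a) `[(- a)%R, (1 - a)%R] f ltr01.
rewrite [LHS](_ : _ = \int[mu]_(y in `[(- a)%R, (1 - a)%R]) f y); last first.
  rewrite E// mul1e preimage_affine_itv// !divr1 subrr opprK subrK.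
  by apply: eq_integral => y _; rewrite mul1r.
rewrite (@ge0_integral_itv_split _ _ 0%R)//= ?bnd_simp ?oppr_le0 ?subr_ge0//.
congr (_ + _).
rewrite ge0_integral_reflect// opp_preimage_itvbndbnd/= oppr0 opprK.
by apply: eq_integral => y _.
Qed.

Lemma ge0_integral_evenT (f : R -> \bar R) :
  measurable_fun [set: R] f -> (forall x, 0 <= f x) ->
  (forall x, f (- x)%R = f x) ->
  \int[mu]_y f y = 2%:E * \int[mu]_(y in `[0%R, +oo[) f y.
Proof.
move=> mf f0 fe.
rewrite -set_itvNyy (@ge0_integral_itv_split _ _ 0%R)//=.
rewrite (_ : \int[mu]_(y in `]-oo, 0%R]) f y = \int[mu]_(y in `[0%R, +oo[) f y).
  by rewrite -mule2n mule_natl.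
rewrite [RHS]ge0_integral_reflect// opp_preimage_itvbndy oppr0.
by apply: eq_integral => y _; rewrite fe.
Qed.

Lemma ge0_integral_half (f : R -> \bar R) :
  measurable_fun [set: R] f -> (forall x, 0 <= f x) ->
  (forall x : R, (0 <= x <= 1)%R -> f (1 - x)%R = f x) ->
  \int[mu]_(y in `[0%R, 1%R]) f y =
  2%:E * \int[mu]_(y in `[0%R, (1 / 2)%R]) f y.
Proof.
move=> mf f0 fe.
rewrite (@ge0_integral_itv_split _ _ (1/2)%R)//= ?bnd_simp; [|lra|lra].
rewrite [X in _ + X](_ : _ = \int[mu]_(y in `[0%R, (1 / 2)%R]) f y).
  by rewrite -mule2n mule_natl.
rewrite [LHS](@ge0_integral_affine _ 1 1)// mul1e preimage_affine_itv//.
rewrite [RHS]ge0_integral_reflect// opp_preimage_itvbndbnd/= oppr0.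
rewrite (_ : (1 / 2 - 1) / 1 = - (1 / 2))%R; last by field.
rewrite (_ : (1 - 1) / 1 = 0)%R; last by field.
apply: eq_integral => y; rewrite inE/= in_itv/= => /andP[y0 y1].
by rewrite -fe; [congr f; lra|lra].
Qed.

Lemma ge0_integral_scale (c : R) (f : R -> \bar R) :
  (0 < c)%R -> measurable_fun [set: R] f -> (forall x, 0 <= f x) ->
  \int[mu]_(t in `[0%R, +oo[) f t =
  c%:E * \int[mu]_(t in `[0%R, +oo[) f (c * t)%R.
Proof.
move=> c0 mf f0; rewrite (@ge0_integral_affine _ c 0)// preimage_affine_itvy//.
rewrite subr0 mul0r; congr (_ * _); apply: eq_integral => t _.
by rewrite addr0.
Qed.

End one_dimensional_integrals.

(** * Iterated integrals over boxes *)

Section iterated_integrals.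
Context {R : realType}.
Local Notation mu := (@lebesgue_measure R).
Local Open Scope ereal_scope.

(** The iterated form lets the one-dimensional substitutions act on each variable separately;
    Tonelli's theorem links it to the plane. *)
Definition box_integral (X Y : set R) (f : R * R -> R) : \bar R :=
  \int[mu]_(x in X) \int[mu]_(y in Y) (f (x, y))%:E.

(** Extension by zero outside [Y] turns the partial integral into a section integral, whose
    measurability is part of Tonelli's theorem. The parameter space is arbitrary so that the lemma
    can be applied twice in a row. *)
Lemma measurable_param_integral d (T : measurableType d) (Y : set R)
    (F : T * R -> \bar R) :
  measurable Y -> measurable_fun [set: T * R] F -> (forall z, 0 <= F z) ->
  measurable_fun [set: T] (fun x : T => \int[mu]_(y in Y) F (x, y)).
Proof.
move=> mY mF F0.
have mTY : measurable ([set: T] `*` Y) by exact: measurableX.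
have mFY : measurable_fun [set: T * R] (F \_ ([set: T] `*` Y)).
  by apply/(measurable_restrictT _ _).1 => //; exact: measurable_funTS.
have FY0 z : 0 <= (F \_ ([set: T] `*` Y)) z by rewrite erestrict_ge0.
rewrite (_ : (fun _ => _) = fubini_F mu (F \_ ([set: T] `*` Y))).
  exact: measurable_fun_fubini_tonelli_F.
apply/funext => x; rewrite /fubini_F [LHS]integral_mkcond.
apply: eq_integral => y _; rewrite !patchE /=.
by rewrite in_setX/= in_setT.
Qed.

Lemma measurable_section_integral (Y : set R) (F : R * R -> \bar R) :
  measurable Y -> measurable_fun [set: R * R] F -> (forall z, 0 <= F z) ->
  measurable_fun [set: R] (fun x : R => \int[mu]_(y in Y) F (x, y)).
Proof. exact: measurable_param_integral. Qed.

Lemma ge0_integral_setX (X Y : set R) (F : R * R -> \bar R) :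
  measurable X -> measurable Y -> measurable_fun [set: R * R] F ->
  (forall z, 0 <= F z) ->
  \int[@leb2 R]_(z in X `*` Y) F z =
  \int[mu]_(x in X) \int[mu]_(y in Y) F (x, y).
Proof.
move=> mX mY mF F0.
have mXY : measurable (X `*` Y) by exact: measurableX.
rewrite [LHS]integral_mkcond /leb2 fubini_tonelli1; last 2 first.
- by apply/(measurable_restrictT _ _).1 => //; exact: measurable_funTS.
- by move=> z; rewrite erestrict_ge0.
rewrite [RHS]integral_mkcond; apply: eq_integral => x _.
rewrite /fubini_F patchE; case: ifPn => xX.
  rewrite [RHS]integral_mkcond; apply: eq_integral => y _.
  by rewrite !patchE in_setX/= xX.
rewrite integral0_eq// => y _.
by rewrite patchE in_setX/= (negbTE xX).
Qed.

Lemma ge0_integral_setX_swap (X Y : set R) (F : R * R -> \bar R) :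
  measurable X -> measurable Y -> measurable_fun [set: R * R] F ->
  (forall z, 0 <= F z) ->
  \int[mu]_(x in X) \int[mu]_(y in Y) F (x, y) =
  \int[mu]_(y in Y) \int[mu]_(x in X) F (x, y).
Proof.
move=> mX mY mF F0.
have mXY : measurable (X `*` Y) by exact: measurableX.
rewrite -ge0_integral_setX// [LHS]integral_mkcond /leb2 fubini_tonelli2; last 2 first.
- by apply/(measurable_restrictT _ _).1 => //; exact: measurable_funTS.
- by move=> z; rewrite erestrict_ge0.
rewrite [RHS]integral_mkcond; apply: eq_integral => y _.
rewrite /fubini_G patchE; case: ifPn => yY.
  rewrite [RHS]integral_mkcond; apply: eq_integral => x _.
  by rewrite !patchE in_setX/= yY andbT.
rewrite integral0_eq// => x _.
by rewrite patchE in_setX/= (negbTE yY) andbF.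
Qed.

Lemma measurable_sectionl (F : R * R -> \bar R) (x : R) :
  measurable_fun [set: R * R] F -> measurable_fun [set: R] (fun y => F (x, y)).
Proof. by move=> mF; exact: measurableT_comp. Qed.

(** The parallels to the axes through [(a, b)] cut the square into four boxes with a common corner;
    evenness in each coordinate moves all of them into the positive quadrant. *)
Lemma box_integral_shift (f : R * R -> R) (a b : R) :
  measurable_fun [set: R * R] f -> (forall z, (0 <= f z)%R) ->
  (forall x y, f (- x, y)%R = f (x, y)) -> (forall x y, f (x, - y)%R = f (x, y)) ->
  (0 <= a <= 1)%R -> (0 <= b <= 1)%R ->
  \int[@leb2 R]_(y in @unit_square R) (f (y - (a, b)))%:E =
  box_integral `[0%R, a] `[0%R, b] f +
  box_integral `[0%R, a] `[0%R, (1 - b)%R] f +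
  (box_integral `[0%R, (1 - a)%R] `[0%R, b] f +
  box_integral `[0%R, (1 - a)%R] `[0%R, (1 - b)%R] f).
Proof.
move=> mf f0 fl fr a01 b01.
have mF : measurable_fun [set: R * R] (EFin \o f) by exact/measurable_EFinP.
have mS (Y : set R) : measurable Y ->
    measurable_fun [set: R] (fun u : R => \int[mu]_(v in Y) (f (u, v))%:E).
  move=> mY; exact: (@measurable_section_integral Y (EFin \o f)).
have mFab : measurable_fun [set: R * R] (fun z : R * R => (f (z - (a, b)))%:E).
  apply/measurable_EFinP; apply: measurableT_comp => //.
  rewrite (_ : (fun _ => _) = fun z : R * R => (z.1 - a, z.2 - b)%R).
    by apply/measurable_fun_pair; [exact: measurable_funB|exact: measurable_funB].
  by apply/funext => -[].
rewrite /unit_square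
  (@ge0_integral_setX _ _ (fun z => (f (z - (a, b)))%:E))//; last first.
  by move=> z; rewrite lee_fin.
pose H (u : R) := \int[mu]_(v in `[0%R, b]) (f (u, v))%:E +
  \int[mu]_(v in `[0%R, (1 - b)%R]) (f (u, v))%:E.
have mH : measurable_fun [set: R] H.
  by apply: emeasurable_funD; exact: mS.
have H0 u : 0 <= H u by apply: adde_ge0; apply: integral_ge0 => v _; rewrite lee_fin.
under eq_integral => x _.
  rewrite (_ : \int[mu]_(y in _) _ = H (x - a)%R); last first.
    apply: (@ge0_integral_even_shift _ b (fun v => (f (x - a, v)%R)%:E)) => //.
    - exact: (measurable_sectionl (x - a) mF).
    - by move=> v; rewrite lee_fin.
    - by move=> v; rewrite fr.
  over.
rewrite (ge0_integral_even_shift a01 mH H0); last first.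
  by move=> u; rewrite /H; congr (_ + _); apply: eq_integral => v _; rewrite fl.
have B0 (Y : set R) u : 0 <= \int[mu]_(v in Y) (f (u, v))%:E.
  by apply: integral_ge0 => v _; rewrite lee_fin.
by congr (_ + _); rewrite ge0_integralD//; apply: measurable_funTS; exact: mS.
Qed.

End iterated_integrals.

Lemma integral_itv_cst {R : realType} (a : R) (k : \bar R) : (0 <= a)%R ->
  (\int[@lebesgue_measure R]_(x in `[0%R, a]) k = k * a%:E)%E.
Proof.
move=> a0; rewrite integral_cst//= lebesgue_measure_itv/= lte_fin.
case: ltgtP a0 => // [a0 _|<- _]; first by rewrite oppr0 adde0.
by rewrite mule0.
Qed.

(** * Box integrals of a radially decreasing function *)

Section radial_box_integrals.
Context {R : realType}.
Local Notation mu := (@lebesgue_measure R).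
Local Open Scope ereal_scope.

Lemma oneDsqr_gt0 (x : R) : (0 < oneDsqr x)%R.
Proof. exact: lt_le_trans ltr01 (oneDsqr_ge1 x). Qed.

Lemma measurable_oneDsqrV_scale (r : R) :
  measurable_fun [set: R] (fun x : R => (oneDsqr (x / r))^-1)%R.
Proof.
apply: (@measurableT_comp _ _ _ _ _ _ (fun y : R => (oneDsqr y)^-1)%R).
  by apply: continuous_measurable_fun; exact: continuous_oneDsqrV.
exact: measurable_funM.
Qed.

(** The Cauchy profile at scale [r] serves as integrable majorant in all decay estimates, because
    its integral is explicit. *)
Lemma integral0y_oneDsqr_scale (r : R) : (0 < r)%R ->
  \int[mu]_(x in `[0%R, +oo[) ((oneDsqr (x / r))^-1)%:E = (r * (pi / 2))%:E.
Proof.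
move=> r0.
have mo := (measurable_EFinP _ _).2 (measurable_oneDsqrV_scale r).
rewrite (ge0_integral_scale r0 mo); last first.
  by move=> x; rewrite lee_fin invr_ge0 (ltW (oneDsqr_gt0 _)).
rewrite EFinM -integral0y_oneDsqr; congr (_ * _).
by apply: eq_integral => x _ /=; rewrite mulrAC mulfV ?mul1r// gt_eqF.
Qed.

Variables (f : R * R -> R).
Hypothesis mf : measurable_fun [set: R * R] f.
Hypothesis f_ge0 : forall z, (0 <= f z)%R.
Hypothesis f_radial : forall x y, (enorm2 x <= enorm2 y -> f y <= f x)%R.

Let p := f (0, 0)%R.
Let profile_integral := \int[mu]_(t in `[0%R, +oo[) (f (t, 0%R))%:E.

Lemma radial_le (x y x' y' : R) : (`|x| <= `|x'| -> `|y| <= `|y'| ->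
  f (x', y') <= f (x, y))%R.
Proof.
move=> xx yy; apply: f_radial; rewrite /enorm2/= ler_wsqrtr// lerD//.
  by rewrite -(real_normK (num_real x)) -(real_normK (num_real x')) ler_sqr// nnegrE.
by rewrite -(real_normK (num_real y)) -(real_normK (num_real y')) ler_sqr// nnegrE.
Qed.

Lemma radial_eq (x y x' y' : R) : (x ^+ 2 + y ^+ 2 = x' ^+ 2 + y' ^+ 2 ->
  f (x, y) = f (x', y'))%R.
Proof.
by move=> e; apply/le_anti/andP; split; apply: f_radial; rewrite /enorm2/= e.
Qed.

Lemma radial_le_max z : (f z <= p)%R.
Proof.
by apply: f_radial; rewrite /enorm2/= expr0n/= addr0 sqrtr0 sqrtr_ge0.
Qed.

Let F0 z : 0 <= (f z)%:E.
Proof. by rewrite lee_fin. Qed.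

Let mF : measurable_fun [set: R * R] (EFin \o f).
Proof. exact/measurable_EFinP. Qed.

Let mS (D : set (measurableTypeR R)) (Y : set R) : measurable Y ->
  measurable_fun D (fun u : measurableTypeR R => \int[mu]_(v in Y) (f (u, v))%:E).
Proof.
by move=> mY; apply: measurable_funTS; exact: (@measurable_section_integral _ Y (EFin \o f)).
Qed.

Let S0 (Y : set R) u : 0 <= \int[mu]_(v in Y) (f (u, v))%:E.
Proof. by apply: integral_ge0 => v _; rewrite lee_fin. Qed.

Let mV (D : set (measurableTypeR R)) u : measurable_fun D (fun v : measurableTypeR R => (f (u, v))%:E).
Proof. have h := measurable_sectionl u mF; exact: measurable_funTS h. Qed.

Let mprofile (D : set (measurableTypeR R)) : measurable_fun D (fun v : measurableTypeR R => (f (v, 0%R))%:E).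
Proof.
have mp : measurable_fun [set: R] (fun v : R => (v, 0%R : R)) by exact: measurable_fun_pair.
have h := measurableT_comp mF mp; exact: measurable_funTS h.
Qed.

Lemma box_integral_ge0 X Y : 0 <= box_integral X Y f.
Proof. by apply: integral_ge0 => x _; exact: S0. Qed.

Lemma box_integral_sym X Y : measurable X -> measurable Y ->
  box_integral X Y f = box_integral Y X f.
Proof.
move=> mX mY; rewrite /box_integral (ge0_integral_setX_swap mX mY mF)//.
apply: eq_integral => y _; apply: eq_integral => x _; congr EFin.
by apply: radial_eq; rewrite addrC.
Qed.

Lemma box_integral_subset X X' Y Y' : measurable X -> measurable Y ->
  measurable X' -> measurable Y' ->
  X `<=` X' -> Y `<=` Y' -> box_integral X Y f <= box_integral X' Y' f.
Proof.
move=> mX mY mX' mY' XX YY.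
apply: (@le_trans _ _ (box_integral X' Y f)).
  by apply: ge0_subset_integral => //; exact: mS.
apply: ge0_le_integral => //.
- exact: mS.
- exact: mS.
- move=> x _; apply: ge0_subset_integral => //.
Qed.

Lemma box_integral_splitr X (b : R) : measurable X -> (0 <= b)%R ->
  box_integral X `[0%R, +oo[ f =
  box_integral X `[0%R, b] f + box_integral X `[b, +oo[ f.
Proof.
move=> mX b0; rewrite /box_integral -[RHS]ge0_integralD//; try exact: mS.
apply: eq_integral => x _.
apply: (@ge0_integral_itv_split _ (BLeft 0%R) +oo%O b (fun y => (f (x, y))%:E)) => //.
exact: mV.
Qed.

Lemma box_integral_le_area a b : (0 <= a)%R -> (0 <= b)%R ->
  box_integral `[0%R, a] `[0%R, b] f <= (p * a * b)%:E.
Proof.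
move=> a0 b0.
apply: (@le_trans _ _ (\int[mu]_(x in `[0%R, a]) \int[mu]_(y in `[0%R, b]) p%:E)).
  apply: ge0_le_integral => //; first exact: mS.
  move=> x _; apply: ge0_le_integral => //.


  - by move=> y _; rewrite lee_fin radial_le_max.
rewrite integral_itv_cst// integral_itv_cst//.
by rewrite -!EFinM lee_fin mulrAC.
Qed.

Lemma box_integral_ge_area (c a b : R) : (0 <= a)%R -> (0 <= b)%R -> (0 <= c)%R ->
  (c <= f (a, b))%R ->
  (c * a * b)%:E <= box_integral `[0%R, a] `[0%R, b] f.
Proof.
move=> a0 b0 c0 cf.
rewrite (_ : (c * a * b)%:E =
    \int[mu]_(x in `[0%R, a]) \int[mu]_(y in `[0%R, b]) c%:E); last first.
  by rewrite integral_itv_cst// integral_itv_cst// -!EFinM mulrAC.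
apply: ge0_le_integral => //.
- by move=> x _; apply: integral_ge0 => y _; rewrite lee_fin.
- exact: mS.
move=> x /=; rewrite in_itv/= => /andP[x0 xa].
apply: ge0_le_integral => // y; rewrite /= in_itv/= => /andP[y0 yb].
by rewrite lee_fin (le_trans cf)// radial_le// !ger0_norm.
Qed.

(** Every slice lies below the slice through the origin, which by rotation is the profile. *)
Lemma strip_integral_le a : (0 <= a)%R ->
  box_integral `[0%R, a] `[0%R, +oo[ f <= profile_integral * a%:E.
Proof.
move=> a0; rewrite -integral_itv_cst//.
apply: ge0_le_integral => //; first exact: mS.
move=> x _; apply: ge0_le_integral => // y _.
by rewrite lee_fin (@radial_eq y 0 0 y) ?radial_le ?normr0// addrC.
Qed.

(* Since [|(u, v)| <= u + v], the slice at height [u] dominates the tail of the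
   profile beyond [u], which misses at most [p u] of its integral. *)
Lemma strip_integral_ge a : (0 <= a)%R ->
  profile_integral * a%:E <=
  box_integral `[0%R, a] `[0%R, +oo[ f + (p * a * a)%:E.
Proof.
move=> a0; rewrite /box_integral [(p * a * a)%:E]EFinM.
rewrite -integral_itv_cst// -[in leRHS]integral_itv_cst// -ge0_integralD//; last 2 first.
- exact: mS.
- by move=> x _; rewrite lee_fin mulr_ge0// /p.
apply: ge0_le_integral => //.
- by move=> x _; apply: integral_ge0.
- by apply: emeasurable_funD => //; exact: mS.
move=> u /=; rewrite in_itv/= => /andP[u0 ua].
rewrite /profile_integral (@ge0_integral_itv_split _ _ _ u)//.
rewrite addeC leeD//; last first.
  apply: (@le_trans _ _ (\int[mu]_(x in `[0%R, u]) p%:E)).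
    by apply: ge0_le_integral => // x _; rewrite lee_fin radial_le_max.
  by rewrite integral_itv_cst// -EFinM lee_fin ler_wpM2l// /p.
rewrite (@ge0_integral_affine _ 1 u)//; last exact: mprofile.
rewrite mul1e preimage_affine_itvy// subrr mul0r.
apply: ge0_le_integral => //.
  apply: measurable_funTS.
  apply: (@measurableT_comp _ _ _ _ _ _ (fun v : R => (f (v, 0%R))%:E)); first exact: mprofile.
  exact: measurable_affine.
move=> v /=; rewrite in_itv/= andbT => v0.
rewrite lee_fin mul1r; apply: f_radial; rewrite /enorm2/= expr0n/= addr0.
  by rewrite ler_wsqrtr//; nra.
exact: mprofile.
Qed.

(* Polar coordinates without a change of variables theorem: substitute
   [v = u w] in the inner integral, exchange the integrals, rescale
   [u (1 + w^2)^(1/2)] to [t], and use [atan +oo = pi / 2]. *)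
Lemma quadrant_integral_polar :
  box_integral `[0%R, +oo[ `[0%R, +oo[ f =
  (pi / 2)%:E * \int[mu]_(t in `[0%R, +oo[) (f (t, 0) * t)%:E%R.
Proof.
(* The absolute value keeps the integrand nonnegative on the whole plane, as the Tonelli lemmas
   require. *)
pose G (z : R * R) := (f (z.1 * Num.sqrt (1 + z.2 ^+ 2), 0) * `|z.1|)%R.
have msq : measurable_fun [set: R] (fun y : R => Num.sqrt (1 + y ^+ 2))%R.
  apply: (@measurableT_comp _ _ _ _ _ _ (@Num.sqrt R)).
    by apply: continuous_measurable_fun; exact: sqrt_continuous.
  by apply: measurable_funD => //; exact: exprn_measurable.
have mG : measurable_fun [set: R * R] (EFin \o G).
  apply/measurable_EFinP; apply: measurable_funM; last exact: measurableT_comp.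
  apply: (@measurableT_comp _ _ _ _ _ _ (fun v : R => f (v, 0%R))).
    by apply/measurable_EFinP; exact: mprofile.
  by apply: measurable_funM => //; exact: (measurableT_comp msq measurable_snd).
have G0 z : 0 <= (EFin \o G) z by rewrite lee_fin mulr_ge0.
pose M := \int[mu]_(t in `[0%R, +oo[) (f (t, 0) * `|t|)%:E%R.
have mM : measurable_fun [set: R] (fun t : R => (f (t, 0) * `|t|)%:E%R).
  apply/measurable_EFinP; apply: measurable_funM => //.
  by apply/measurable_EFinP; exact: mprofile.
have -> : \int[mu]_(t in `[0%R, +oo[) (f (t, 0) * t)%:E%R = M.
  apply: eq_integral => t; rewrite inE/= in_itv/= andbT => t0.
  by rewrite ger0_norm.
(* The point [u = 0] is removed because the substitution [v = u w] degenerates there. *)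
rewrite /box_integral -integral_itv_obnd_cbnd; last exact: mS.
transitivity (\int[mu]_(u in `]0%R, +oo[) \int[mu]_(w in `[0%R, +oo[) (EFin \o G) (u, w)).
  apply: eq_integral => u; rewrite inE/= in_itv/= andbT => u0.
  rewrite (ge0_integral_scale u0)//; last exact: mV.
  rewrite -ge0_integralZl_EFin//; last 2 first.
  - apply: (@measurableT_comp _ _ _ _ _ _ (fun v : R => (f (u, v))%:E)); first exact: mV.
    exact: measurable_funM.
  - exact: ltW.
  apply: eq_integral => w _; rewrite -EFinM /G/= mulrC gtr0_norm//.
  rewrite (@radial_eq u (u * w) (u * Num.sqrt (1 + w ^+ 2)) 0)//.
  rewrite [RHS]addrC expr0n/= add0r !exprMn sqr_sqrtr; first by ring.
  by rewrite addr_ge0// sqr_ge0.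
rewrite (ge0_integral_setX_swap _ _ mG)//.
rewrite -integral0y_oneDsqr -ge0_integralZr//; last 2 first.
- apply/measurable_EFinP/measurable_funTS.
  exact: (continuous_measurable_fun (@continuous_oneDsqrV R)).
- by apply: integral_ge0 => t _; rewrite lee_fin mulr_ge0.
apply: eq_integral => w _; rewrite integral_itv_obnd_cbnd; last first.
  by apply: measurable_funTS; exact: (measurable_fun_pair1 w mG).
have s1 : (0 < 1 + w ^+ 2 :> R)%R by rewrite ltr_wpDr// sqr_ge0.
have s0 : (0 < Num.sqrt (1 + w ^+ 2) :> R)%R by rewrite sqrtr_gt0.
have -> : M = (1 + w ^+ 2)%:E * \int[mu]_(u in `[0%R, +oo[) (EFin \o G) (u, w).
  rewrite /M (ge0_integral_scale s0 mM)//; last first.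
    by move=> t; rewrite lee_fin mulr_ge0.
  (* One square root is the Jacobian of the rescaling, the other comes out of the weight [|t|]. *)
  have sE : (1 + w ^+ 2 = Num.sqrt (1 + w ^+ 2) * Num.sqrt (1 + w ^+ 2))%R.
    by rewrite -expr2 sqr_sqrtr// ltW.
  rewrite [in RHS]sE EFinM -muleA; congr (_ * _).
  rewrite -ge0_integralZl_EFin//; last first.
    by apply: measurable_funTS; exact: (measurable_fun_pair1 w mG).
  apply: eq_integral => u _; rewrite -EFinM /G/= normrM (gtr0_norm s0).
  by congr EFin; rewrite [(u * _)%R]mulrC; ring.
by rewrite muleA -EFinM mulVf ?gt_eqF// mul1e.
Qed.

Lemma plane_integral_quadrant :
  \int[@leb2 R]_z (f z)%:E = 4%:E * box_integral `[0%R, +oo[ `[0%R, +oo[ f.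
Proof.
have -> : \int[@leb2 R]_z (f z)%:E = \int[mu]_x \int[mu]_y (f (x, y))%:E.
  by rewrite -(ge0_integral_setX measurableT measurableT mF)// setXTT.
have fe x y : f (x, - y)%R = f (x, y) by apply: radial_eq; rewrite sqrrN.
have fe' x y : f (- x, y)%R = f (x, y) by apply: radial_eq; rewrite sqrrN.
under eq_integral => x _.
  rewrite (ge0_integral_evenT (f := fun y => (f (x, y))%:E))//; last 2 first.
  - exact: mV.
  - by move=> y; rewrite fe.
  over.
rewrite ge0_integralZl//; last exact: mS.
rewrite ge0_integral_evenT//; last 2 first.
- exact: mS.
- by move=> x; apply: eq_integral => y _; rewrite fe'.
by rewrite muleA -EFinM -natrM.
Qed.

(** This is where the exponent 6 comes from: two powers give the gain [(1 + T / r) ^- 2], and two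
    more for each of [u] and [v] give Cauchy profiles, which make the double integral converge. *)
Lemma quadrant_tail_le (K r T : R) : (0 <= K)%R -> (0 < r)%R -> (0 <= T)%R ->
  (forall z, f z <= K * (1 + enorm2 z / r) ^- 6)%R ->
  box_integral `[0%R, +oo[ `[T, +oo[ f <= (K * (pi / 2) ^+ 2 * r ^+ 2 * (1 + T / r) ^- 2)%:E.
Proof.
move=> K0 r0 T0 fK.
pose e (u : R) := (oneDsqr (u / r))^-1%R.
have e0 u : (0 <= e u)%R by rewrite invr_ge0 (ltW (oneDsqr_gt0 _)).
have me : measurable_fun [set: R] e := measurable_oneDsqrV_scale r.
set K' := (K * (1 + T / r) ^- 2)%R.
have K'0 : (0 <= K')%R by rewrite mulr_ge0// invr_ge0 exprn_ge0// addr_ge0// divr_ge0// ltW.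
have fe u v : (T <= v -> f (u, v) <= K' * e u * e v)%R.
  move=> Tv; apply: (le_trans (fK _)); rewrite /K' -!mulrA ler_wpM2l//.
  have E1 : (u ^+ 2 <= enorm2 (u, v) ^+ 2)%R.
    by rewrite sqr_sqrtr/= ?addr_ge0 ?sqr_ge0// lerDl sqr_ge0.
  have E2 : (v ^+ 2 <= enorm2 (u, v) ^+ 2)%R.
    by rewrite sqr_sqrtr/= ?addr_ge0 ?sqr_ge0// lerDr sqr_ge0.
  have E3 : (T <= enorm2 (u, v))%R.
    by rewrite -(@ler_pXn2r _ 2)// ?nnegrE ?sqrtr_ge0// (le_trans _ E2)// ler_pXn2r ?nnegrE// (le_trans T0).
  set E := (enorm2 (u, v) / r)%R.
  have E0 : (0 <= E)%R by rewrite divr_ge0 ?sqrtr_ge0// ltW.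
  have oE x : (x ^+ 2 <= enorm2 (u, v) ^+ 2 -> oneDsqr (x / r) <= (1 + E) ^+ 2)%R.
    move=> xE; have : ((x / r) ^+ 2 <= E ^+ 2)%R.
      by rewrite !expr_div_n ler_pM2r// invr_gt0 exprn_gt0.
    by rewrite /oneDsqr; nra.
  rewrite -!invfM lef_pV2 ?posrE; last 2 first.
  - by rewrite exprn_gt0// ltr_wpDr.
  - apply: mulr_gt0; last by rewrite mulr_gt0 ?oneDsqr_gt0.
    by rewrite exprn_gt0// ltr_wpDr// divr_ge0// ltW.
  rewrite (_ : (1 + E) ^+ 6 = (1 + E) ^+ 2 * ((1 + E) ^+ 2 * (1 + E) ^+ 2))%R; last by ring.
  have A0 : (0 <= 1 + T / r)%R by rewrite addr_ge0// divr_ge0// ltW.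
  have B0 : (0 <= 1 + E)%R by rewrite addr_ge0.
  apply: ler_pM; rewrite ?mulr_ge0 ?(ltW (oneDsqr_gt0 _)) ?sqr_ge0//.
    rewrite ler_pXn2r ?nnegrE//.
    by rewrite lerD2l ler_pM2r ?invr_gt0.
  by apply: ler_pM; rewrite ?(ltW (oneDsqr_gt0 _)) ?oE.
set c := (r * (pi / 2) : R)%R.
have c0 : (0 <= c)%R by rewrite /c mulr_ge0 ?divr_ge0 ?pi_ge0// ltW.
rewrite (_ : (K * (pi / 2) ^+ 2 * r ^+ 2 * (1 + T / r) ^- 2)%:E = (K' * c)%:E * c%:E); last first.
  by rewrite -EFinM; congr EFin; rewrite /K' /c; move: ((1 + T / r) ^- 2)%R => w; field.
rewrite {2}/c -(integral0y_oneDsqr_scale r0) -ge0_integralZl_EFin//; last 2 first.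
- by apply/measurable_EFinP/measurable_funTS.
- by rewrite mulr_ge0.
apply: ge0_le_integral => //.
- exact: mS.
- by apply/measurable_EFinP; apply: measurable_funM => //; exact: measurable_funTS.
move=> u _; rewrite -EFinM mulrAC EFinM.
rewrite -[c%:E](integral0y_oneDsqr_scale r0) -ge0_integralZl_EFin//; last 2 first.
- by apply/measurable_EFinP/measurable_funTS.
- by rewrite mulr_ge0.
apply: (@le_trans _ _ (\int[mu]_(v in `[T, +oo[) ((K' * e u)%:E * (e v)%:E))).
  apply: ge0_le_integral => //.
  - by apply/measurable_EFinP; apply: measurable_funM => //; exact: measurable_funTS.
  - by move=> v /=; rewrite in_itv/= andbT => Tv; rewrite lee_fin fe.
apply: ge0_subset_integral => //.
- by apply/measurable_EFinP; apply: measurable_funM => //; exact: measurable_funTS.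
- by move=> v _; rewrite lee_fin mulr_ge0// mulr_ge0.
- by move=> v /=; rewrite !in_itv/= !andbT; exact: le_trans.
Qed.

Lemma profile_integral_le (K r : R) : (0 <= K)%R -> (0 < r)%R ->
  (forall z, f z <= K * (1 + enorm2 z / r) ^- 6)%R ->
  profile_integral <= (K * (r * (pi / 2)))%:E.
Proof.
move=> K0 r0 fK.
have me := measurable_oneDsqrV_scale r.
rewrite EFinM -(integral0y_oneDsqr_scale r0) -ge0_integralZl_EFin//; last first.
  by apply/measurable_EFinP/measurable_funTS.
apply: ge0_le_integral => //.
  by apply/measurable_EFinP; apply: measurable_funM => //; exact: measurable_funTS.
move=> t /=; rewrite in_itv/= andbT => t0.
rewrite lee_fin (le_trans (fK _))// ler_wpM2l// /enorm2/= expr0n/= addr0 sqrtr_sqr.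
have E0 : (0 <= t / r)%R by rewrite divr_ge0// ltW.
rewrite ger0_norm// lef_pV2 ?posrE ?oneDsqr_gt0// ?exprn_gt0 ?ltr_wpDr//.
apply: (@le_trans _ _ ((1 + t / r) ^+ 2)%R); first by rewrite /oneDsqr; nra.
by rewrite ler_weXn2l// lerDl.
Qed.

Lemma profile_integral_ge (c r : R) : (0 <= c)%R -> (0 < r)%R ->
  (forall z, enorm2 z < r -> c <= f z)%R ->
  (c * r)%:E <= profile_integral.
Proof.
move=> c0 r0 fc.
rewrite EFinM -(integral_itv_cst _ (ltW r0)) -integral_itv_bndo_bndc//.
apply: (@le_trans _ _ (\int[mu]_(t in `[0%R, r[) (f (t, 0%R))%:E)).
  apply: ge0_le_integral => // t /=; rewrite in_itv/= => /andP[t0 tr].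
  by rewrite lee_fin fc// /enorm2/= expr0n/= addr0 sqrtr_sqr ger0_norm.
apply: ge0_subset_integral => // t /=; rewrite !in_itv/= andbT.
by case/andP.
Qed.

End radial_box_integrals.

(** * Product integrands on a quarter of the unit square *)

Section product_integrands.
Context {R : realType}.
Local Notation mu := (@lebesgue_measure R).
Local Notation half := (`[0%R, (1 / 2)%R]%classic : set R).
Local Open Scope ereal_scope.

(** Measurability, sign and value travel together, so that a piecewise majorant can be integrated by
    assembling its product summands. *)
Definition half_integral (h : R -> R) (c : R) : Prop :=
  [/\ measurable_fun [set: R] h, (forall x, 0 <= h x)%R &
      \int[mu]_(x in half) (h x)%:E = c%:E].

Definition quarter_integral (g : R * R -> R) (c : R) : Prop :=
  [/\ measurable_fun [set: R * R] g, (forall z, 0 <= g z)%R &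
      box_integral half half g = c%:E].

Lemma half_integral_restrict (A : set R) (h : R -> R) (c : R) :
  measurable A -> measurable_fun [set: R] h -> (forall x, 0 <= h x)%R ->
  \int[mu]_(x in half `&` A) (h x)%:E = c%:E ->
  half_integral (fun x => \1_A x * h x)%R c.
Proof.
move=> mA mh h0 hc; split.
- by apply: measurable_funM => //; exact: measurable_indic.
- by move=> x; rewrite mulr_ge0.
rewrite -hc integral_mkcondr; apply: eq_integral => x _.
by rewrite patchE indicE; case: ifPn => _; rewrite ?mul1r ?mul0r.
Qed.

Lemma half_integral_cst1 : half_integral (fun=> 1%R) (1 / 2).
Proof.
by split => //; rewrite integral_itv_cst ?mul1e// divr_ge0.
Qed.

Lemma half_integral_below (T : R) : (0 <= T <= 1 / 2)%R ->
  half_integral (fun x => \1_(`[0%R, T]%classic : set R) x * 1)%R T.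
Proof.
move=> /andP[T0 T1]; apply: half_integral_restrict => //.
rewrite (_ : half `&` _ = `[0%R, T]%classic) ?integral_itv_cst ?mul1e//.
rewrite setIidr// => x /=; rewrite !in_itv/= => /andP[-> xT].
exact: le_trans xT T1.
Qed.

Lemma half_integral_above (d : R) : (0 <= d <= 1 / 2)%R ->
  half_integral (fun x => \1_(`]d, +oo[%classic : set R) x * 1)%R (1 / 2 - d).
Proof.
move=> /andP[d0 d1]; apply: half_integral_restrict => //.
rewrite (_ : half `&` _ = `]d, (1 / 2)%R]%classic).
  rewrite integral_cst//= mul1e lebesgue_measure_itv/= lte_fin.
  case: ltrP => [_|d2]; first by rewrite EFinB.
  by rewrite (_ : 1 / 2 - d = 0)%R//; lra.
apply/seteqP; split => x /=; rewrite !in_itv/= ?andbT => -[].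
  by move=> /andP[_ ->] ->.
by move=> /andP[dx x1]; rewrite x1 dx andbT; split => //; apply: le_trans d0 (ltW dx).
Qed.

(** Up to the factor [k], this is the distribution function of the exponential law of rate [k]. *)
Lemma half_integral_exp (k d : R) : (0 < k)%R -> (0 < d <= 1 / 2)%R ->
  half_integral (fun x => \1_(`[0%R, d]%classic : set R) x * expR (- (k * x)))%R
    ((1 - expR (- (k * d))) / k).
Proof.
move=> k0 /andP[d0 d1]; apply: half_integral_restrict => //.
  by apply: measurableT_comp => //; apply: measurableT_comp => //.
rewrite (_ : half `&` _ = `[0%R, d]%classic); last first.
  rewrite setIidr// => x /=; rewrite !in_itv/= => /andP[-> xT].
  exact: le_trans xT d1.
have := exponential_prob_itv0c k d0.
rewrite /exponential_prob (_ : \int[_]_(x in _) _ =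
    k%:E * \int[mu]_(x in `[0%R, d]) (expR (- (k * x)))%:E); last first.
  rewrite -ge0_integralZl_EFin//; last 2 first.
  - apply/measurable_EFinP/measurable_funTS.
    by apply: measurableT_comp => //; apply: measurableT_comp => //.
  - exact: ltW.
  apply: eq_integral => x; rewrite inE/= in_itv/= => /andP[x0 _].
  by rewrite exponential_pdfE// mulNr -EFinM.
rewrite mulNr -EFinB => /(congr1 (fun e => (k^-1)%:E * e)).
by rewrite muleA -EFinM mulVf ?gt_eqF// mul1e => ->; rewrite -EFinM mulrC.
Qed.

Lemma quarter_integral_prod (h1 h2 : R -> R) (c1 c2 : R) :
  half_integral h1 c1 -> half_integral h2 c2 ->
  quarter_integral (fun z => h1 z.1 * h2 z.2)%R (c1 * c2).
Proof.
move=> [mh1 h10 h1c] [mh2 h20 h2c]; split.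
- apply: measurable_funM; first exact: (measurableT_comp mh1 measurable_fst).
  exact: (measurableT_comp mh2 measurable_snd).
- by move=> z; rewrite mulr_ge0.
have c20 : 0 <= c2%:E by rewrite -h2c; apply: integral_ge0 => x _; rewrite lee_fin.
rewrite EFinM -h1c -ge0_integralZr//; last 2 first.
- by apply/measurable_EFinP/measurable_funTS.
- by move=> x _; rewrite lee_fin.
apply: eq_integral => x _ /=; rewrite -h2c -ge0_integralZl_EFin//.
- by move=> y _; rewrite lee_fin.
- by apply/measurable_EFinP/measurable_funTS.
Qed.

Lemma quarter_integral_add (g1 g2 : R * R -> R) (c1 c2 : R) :
  quarter_integral g1 c1 -> quarter_integral g2 c2 ->
  quarter_integral (fun z => g1 z + g2 z)%R (c1 + c2).
Proof.
move=> [m1 p1 e1] [m2 p2 e2]; split.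
- exact: measurable_funD.
- by move=> z; rewrite addr_ge0.
rewrite /box_integral EFinD -e1 -e2.
have mS (g : R * R -> R) : measurable_fun [set: R * R] g -> (forall z, 0 <= g z)%R ->
    measurable_fun half (fun u : R => \int[mu]_(v in half) (g (u, v))%:E).
  move=> mg g0; apply: measurable_funTS.
  apply: (@measurable_section_integral _ _ (EFin \o g)) => //.
  exact/measurable_EFinP.
have mV (g : R * R -> R) u : measurable_fun [set: R * R] g ->
    measurable_fun half (fun v : R => (g (u, v))%:E).
  move=> /measurable_EFinP mg; apply: measurable_funTS; exact: (measurable_sectionl u mg).
rewrite -[RHS]ge0_integralD//.
- apply: eq_integral => x _.
  rewrite -ge0_integralD//.
  + by move=> y _; rewrite lee_fin.
  + exact: mV.
  + by move=> y _; rewrite lee_fin.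
  + exact: mV.
- by move=> x _; apply: integral_ge0 => y _; rewrite lee_fin.
- exact: mS.
- by move=> x _; apply: integral_ge0 => y _; rewrite lee_fin.
- exact: mS.
Qed.

Lemma quarter_integral_scale (k : R) (g : R * R -> R) (c : R) : (0 <= k)%R ->
  quarter_integral g c -> quarter_integral (fun z => k * g z)%R (k * c).
Proof.
move=> k0 [mg g0 gc]; split.
- exact: measurable_funM.
- by move=> z; rewrite mulr_ge0.
have mF : measurable_fun [set: R * R] (EFin \o g) by exact/measurable_EFinP.
rewrite EFinM -gc /box_integral -ge0_integralZl_EFin//; last 2 first.
- by move=> x _; apply: integral_ge0 => y _; rewrite lee_fin.
- by apply: measurable_funTS; exact: (@measurable_section_integral _ _ (EFin \o g)).
apply: eq_integral => x _; rewrite -ge0_integralZl_EFin//.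
- by move=> y _; rewrite lee_fin.
- by have h := measurable_sectionl x mF; apply: measurable_funTS.
Qed.

Lemma le_box_integral (X Y : set R) (f g : R * R -> R) :
  measurable X -> measurable Y ->
  measurable_fun [set: R * R] f -> measurable_fun [set: R * R] g ->
  (forall z, 0 <= f z)%R -> (forall z, 0 <= g z)%R ->
  (forall x y, X x -> Y y -> f (x, y) <= g (x, y))%R ->
  box_integral X Y f <= box_integral X Y g.
Proof.
move=> mX mY /measurable_EFinP mf /measurable_EFinP mg f0 g0 fg.
apply: ge0_le_integral => //.
- by move=> x _; apply: integral_ge0 => y _; rewrite lee_fin.
- by apply: measurable_funTS; exact: (@measurable_section_integral _ _ (EFin \o f)).
- by apply: measurable_funTS; exact: (@measurable_section_integral _ _ (EFin \o g)).
move=> x Xx; apply: ge0_le_integral => //.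
- by move=> y _; rewrite lee_fin.
- by have h := measurable_sectionl x mf; apply: measurable_funTS.
- by have h := measurable_sectionl x mg; apply: measurable_funTS.
- by move=> y Yy; rewrite lee_fin fg.
Qed.

Lemma unit_square_integral_quarter (G : R * R -> R) :
  measurable_fun [set: R * R] G -> (forall z, 0 <= G z)%R ->
  (forall a b : R, (0 <= a <= 1)%R -> (0 <= b <= 1)%R ->
    G (1 - a, b)%R = G (a, b) /\ G (a, 1 - b)%R = G (a, b)) ->
  \int[@leb2 R]_(z in @unit_square R) (G z)%:E = 4%:E * box_integral half half G.
Proof.
move=> mG G0 Gsym.
have mF : measurable_fun [set: R * R] (EFin \o G) by exact/measurable_EFinP.
have mS (Y : set R) : measurable Y ->
    measurable_fun [set: R] (fun u : R => \int[mu]_(v in Y) (G (u, v))%:E).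
  by move=> mY; exact: (@measurable_section_integral _ Y (EFin \o G)).
have S0 (Y : set R) u : 0 <= \int[mu]_(v in Y) (G (u, v))%:E.
  by apply: integral_ge0 => v _; rewrite lee_fin.
transitivity (box_integral `[0%R, 1%R] `[0%R, 1%R] G).
  have := @ge0_integral_setX R `[0%R, 1%R] `[0%R, 1%R] (EFin \o G).
  by apply => // z; rewrite lee_fin.
pose H (x : R) := \int[mu]_(y in `[0%R, 1%R]) (G (x, y))%:E.
have mH : measurable_fun [set: R] H by exact: mS.
have -> : box_integral `[0%R, 1%R] `[0%R, 1%R] G = 2%:E * \int[mu]_(x in half) H x.
  apply: (ge0_integral_half mH) => [x|x x01]; first exact: S0.
  apply: eq_integral => y; rewrite inE/= in_itv/= => y01.
  by rewrite (Gsym x y x01 y01).1.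
rewrite (_ : \int[mu]_(x in half) H x =
    \int[mu]_(x in half) (2%:E * \int[mu]_(y in half) (G (x, y))%:E)); last first.
  apply: eq_integral => x; rewrite inE/= in_itv/= => /andP[x0 x1].
  rewrite /H (ge0_integral_half (f := fun y => (G (x, y))%:E))//.
  - exact: (measurable_sectionl x mF).
  - by move=> y; rewrite lee_fin.
  - move=> y y01; have x01 : (0 <= x <= 1)%R by lra.
    by rewrite (Gsym x y x01 y01).2.
rewrite ge0_integralZl_EFin//; last exact: measurable_funTS (mS _ _).
by rewrite muleA -EFinM -natrM.
Qed.

End product_integrands.

(** * Two-sided Laplace bounds at fixed parameters *)

Section laplace_bounds.
Context {R : realType}.
(* [B a b], [A a], [Q] stand for the integrals of the connection function over
   [0, a] x [0, b], [0, a] x [0, +oo[ and the quadrant; by symmetry the unit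
   square seen from [(a, b)] splits into the four boxes summed in [S]. *)
Variables (B : R -> R -> R) (A : R -> R) (G : R * R -> R).
Variables (N p j Q tau delta T eps : R).
Hypotheses (N_gt0 : 0 < N) (j_gt0 : 0 < j) (p_ge0 : 0 <= p).
Hypotheses (eps_gt0 : 0 < eps) (eps_lt1 : eps < 1).
Hypotheses (delta_gt0 : 0 < delta) (delta_T : delta <= T) (T_half : T <= 1 / 2).
Hypothesis p_delta : p * delta <= eps * j.
Hypothesis B_ge0 : forall a b : R, 0 <= a -> 0 <= b -> 0 <= B a b.
Hypothesis B_sym : forall a b : R, 0 <= a -> 0 <= b -> B a b = B b a.
Hypothesis B_le_A : forall a b : R, 0 <= a -> 0 <= b -> B a b <= A a.
Hypothesis B_le_area : forall a b : R, 0 <= a -> 0 <= b -> B a b <= p * a * b.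
Hypothesis A_le_Q : forall a : R, 0 <= a -> A a <= Q.
Hypothesis A_mono : forall a b : R, 0 <= a -> a <= b -> A a <= A b.
Hypothesis A_le : forall a : R, 0 <= a -> A a <= j * a.
Hypothesis A_ge : forall a : R, 0 <= a -> j * a <= A a + p * a * a.
Hypothesis A_tail : forall a b : R, 0 <= a -> T <= b -> A a <= B a b + tau.
Hypothesis Q_tail : forall a : R, T <= a -> Q <= A a + tau.

Let S a b := B a b + B a (1 - b) + (B (1 - a) b + B (1 - a) (1 - b)).

Hypothesis mG : measurable_fun [set: R * R] G.
Hypothesis G_ge0 : forall z, 0 <= G z.
Hypothesis GE : forall a b : R, 0 <= a <= 1 -> 0 <= b <= 1 ->
  G (a, b) = expR (- (N * S a b)).

Let T_ge0 : 0 <= T. Proof. exact: le_trans (ltW delta_gt0) delta_T. Qed.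

Let tau_ge0 : 0 <= tau.
Proof. have := Q_tail (lexx T); have := A_le_Q T_ge0; lra. Qed.

Let S_sym a b : 0 <= a <= 1 -> 0 <= b <= 1 ->
  [/\ S (1 - a) b = S a b, S a (1 - b) = S a b & S b a = S a b].
Proof.
move=> /andP[a0 a1] /andP[b0 b1]; rewrite /S !subKr; split; [ring|ring|].
rewrite (@B_sym b a)// (@B_sym b (1 - a)) ?subr_ge0// (@B_sym (1 - b) a) ?subr_ge0//.
rewrite (@B_sym (1 - b) (1 - a)) ?subr_ge0//; ring.
Qed.

(** The small box is dropped, and each cut at distance at least [T] costs one [tau]. The argument
    loses [4 * tau]; the constant 8 is the loss in the interior, taken everywhere so that a single
    prefactor serves all regions. *)
Let S_ge a b : 0 <= a <= 1 / 2 -> 0 <= b <= 1 / 2 -> Q + A a + A b - 8 * tau <= S a b.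
Proof.
move=> /andP[a0 a1] /andP[b0 b1]; rewrite /S.
have a2 : T <= 1 - a by have := T_half; lra.
have b2 : T <= 1 - b by have := T_half; lra.
have h1 := B_ge0 a0 b0.
have h2 := A_tail a0 b2.
have h3 := A_tail b0 a2; rewrite (@B_sym b) in h3; [|lra|lra].
have h4 := A_tail (le_trans T_ge0 a2) b2; have h5 := Q_tail a2.
by have := tau_ge0; lra.
Qed.

(** Both [b] and [1 - b] are at least [T], so all four boxes count: two of them are nearly [A a],
    the other two nearly [Q]. *)
Let S_ge_edge a b : 0 <= a <= 1 / 2 -> T <= b <= 1 / 2 -> 2 * Q + 2 * A a - 6 * tau <= S a b.
Proof.
move=> /andP[a0 a1] /andP[b0 b1]; rewrite /S.
have a2 : T <= 1 - a by have := T_half; lra.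
have b2 : T <= 1 - b by have := T_half; lra.
have h1 := A_tail a0 b0.
have h2 := A_tail a0 b2.
have h3 := A_tail (le_trans T_ge0 a2) b0.
have h4 := A_tail (le_trans T_ge0 a2) b2; have h5 := Q_tail a2.
by have := tau_ge0; lra.
Qed.

(** Below [delta] the quadratic error [p * a * a] is at most the fraction [eps] of the linear term,
    by [p_delta]. *)
Let A_ge_below a : 0 <= a <= delta -> (1 - eps) * j * a <= A a.
Proof.
move=> /andP[a0 ad]; have := A_ge a0.
have : p * a * a <= eps * j * a by rewrite ler_wpM2r// (le_trans _ p_delta)// ler_wpM2l.
lra.
Qed.

Let A_ge_above a : delta <= a -> (1 - eps) * j * delta <= A a.
Proof.
move=> da; have d0 := ltW delta_gt0.
by apply: le_trans (A_mono d0 da); apply: A_ge_below; rewrite d0 lexx.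
Qed.

Let S_ge_corner a b : 0 <= a <= 1 / 2 -> 0 <= b <= 1 / 2 -> a <= delta -> b <= delta ->
  Q + (1 - eps) * j * a + (1 - eps) * j * b - 8 * tau <= S a b.
Proof.
move=> a12 b12 ad bd; have := S_ge a12 b12.
have [/andP[a0 _] /andP[b0 _]] := (a12, b12).
have := @A_ge_below a; rewrite a0 ad => /(_ isT).
have := @A_ge_below b; rewrite b0 bd => /(_ isT).
by lra.
Qed.

Let S_ge_off_corner a b : 0 <= a <= 1 / 2 -> 0 <= b <= 1 / 2 ->
  (delta < a) || (delta < b) -> Q + (1 - eps) * j * delta - 8 * tau <= S a b.
Proof.
move=> a12 b12 dab; have := S_ge a12 b12.
have [/andP[a0 _] /andP[b0 _]] := (a12, b12).
have : 0 <= A a := le_trans (B_ge0 a0 b0) (B_le_A a0 b0).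
have : 0 <= A b := le_trans (B_ge0 b0 a0) (B_le_A b0 a0).
by case/orP: dab => /ltW/A_ge_above; lra.
Qed.

Let S_ge_edge_below a b : 0 <= a <= 1 / 2 -> T <= b <= 1 / 2 -> a <= delta ->
  2 * Q + 2 * ((1 - eps) * j * a) - 8 * tau <= S a b.
Proof.
move=> a12 Tb ad; have := S_ge_edge a12 Tb; have /andP[a0 _] := a12.
have := @A_ge_below a; rewrite a0 ad => /(_ isT); have := tau_ge0.
by lra.
Qed.

Let S_ge_edge_above a b : 0 <= a <= 1 / 2 -> T <= b <= 1 / 2 -> delta < a ->
  2 * Q + 2 * ((1 - eps) * j * delta) - 8 * tau <= S a b.
Proof.
move=> a12 Tb /ltW/A_ge_above; have := S_ge_edge a12 Tb; have := tau_ge0.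
by lra.
Qed.

Let S_ge_interior a b : 0 <= a <= 1 / 2 -> T <= a -> T <= b <= 1 / 2 ->
  4 * Q - 8 * tau <= S a b.
Proof.
move=> a12 Ta Tb; have := S_ge_edge a12 Tb; have := Q_tail Ta.
by lra.
Qed.

Let half_unit (a : R) : 0 <= a <= 1 / 2 -> 0 <= a <= 1.
Proof. by lra. Qed.

(** The small box contributes at most [p * a * b], which [p_delta] absorbs into the factor
    [1 + eps]. *)
Let S_le_corner a b : 0 <= a <= delta -> 0 <= b <= delta ->
  S a b <= Q + (1 + eps) * j * (a + b).
Proof.
move=> /andP[a0 ad] /andP[b0 bd]; rewrite /S.
have d1 : delta <= 1 / 2 := le_trans delta_T T_half.
have a1 : 0 <= 1 - a by lra.
have b1 : 0 <= 1 - b by lra.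
have h1 := B_le_area a0 b0.
have h2 := B_le_A a0 b1; have h3 := B_le_A b0 a1; rewrite (@B_sym b) // in h3.
have h4 := B_le_A a1 b1; have h5 := A_le_Q a1.
have h6 := A_le a0; have h7 := A_le b0.
have h8 : p * a * b <= eps * j * b by rewrite ler_wpM2r// (le_trans _ p_delta)// ler_wpM2l.
have h9 : 0 <= eps * j * a by rewrite !mulr_ge0// ltW.
lra.
Qed.

Let S_le_edge a b : 0 <= a <= 1 -> 0 <= b <= 1 -> S a b <= 2 * Q + 2 * j * a.
Proof.
move=> /andP[a0 a1] /andP[b0 b1]; rewrite /S.
have a2 : 0 <= 1 - a by lra.
have b2 : 0 <= 1 - b by lra.
have h1 := B_le_A a0 b0; have h2 := B_le_A a0 b2.
have h4 := B_le_A a2 b2; have h5 := A_le_Q a2; have h3 := B_le_A a2 b0.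
have h6 := A_le a0.
lra.
Qed.

Let kappa := N * ((1 - eps) * j).
Let kappa' := N * ((1 + eps) * j).

Let kappa_gt0 : 0 < kappa.
Proof. by rewrite /kappa !mulr_gt0// subr_gt0. Qed.

Let kappa'_gt0 : 0 < kappa'.
Proof. by rewrite /kappa' !mulr_gt0// addr_gt0. Qed.

Let G_sym a b : 0 <= a <= 1 -> 0 <= b <= 1 ->
  G (1 - a, b) = G (a, b) /\ G (a, 1 - b) = G (a, b).
Proof.
move=> a01 b01; have [e1 e2 _] := S_sym a01 b01.
have a01' : 0 <= 1 - a <= 1 by lra.
have b01' : 0 <= 1 - b <= 1 by lra.
by rewrite !GE// e1 e2.
Qed.

Let indic_below d x : 0 <= x <= d -> \1_(`[0, d]%classic : set R) x = 1 :> R.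
Proof. by move=> xd; rewrite indicE mem_set//= in_itv. Qed.

Let indic_below0 d x : d < x -> \1_(`[0, d]%classic : set R) x = 0 :> R.
Proof. by move=> xd; rewrite indicE memNset//= in_itv/= => /andP[_]; rewrite leNgt xd. Qed.

Let indic_above d x : d < x -> \1_(`]d, +oo[%classic : set R) x = 1 :> R.
Proof. by move=> xd; rewrite indicE mem_set//= in_itv/= andbT. Qed.

Let indic_above0 d x : x <= d -> \1_(`]d, +oo[%classic : set R) x = 0 :> R.
Proof. by move=> xd; rewrite indicE memNset//= in_itv/= andbT ltNge xd. Qed.

(* The terms are, in order: the four corners, the four edges, points at
   distance at most [T] from two sides and more than [delta] from one, points
   at distance between [delta] and [T] from exactly one side, the interior. *)
Lemma laplace_upper_bound :
  (\int[@leb2 R]_(z in @unit_square R) (G z)%:E <=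
   (expR (8 * (N * tau)) * (4 * expR (- (N * Q)) / kappa ^+ 2 +
     2 * expR (- (2 * (N * Q))) / kappa +
     4 * expR (- (N * Q)) * expR (- (kappa * delta)) * T ^+ 2 +
     4 * expR (- (2 * (N * Q))) * expR (- (2 * (kappa * delta))) * T +
     expR (- (4 * (N * Q)))))%:E)%E.
Proof.
have d12 : 0 < delta <= 1 / 2 by rewrite delta_gt0 (le_trans delta_T).
have T12 : 0 <= T <= 1 / 2 by rewrite T_ge0.
have k2 : 0 < 2 * kappa by rewrite mulr_gt0.
pose e8 := expR (8 * (N * tau)).
pose e1 := expR (- (N * Q)).
pose e2 := expR (- (2 * (N * Q))).
pose e4 := expR (- (4 * (N * Q))).
pose u1 := expR (- (kappa * delta)).
pose u2 := expR (- (2 * (kappa * delta))).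
have h0 := @half_integral_cst1 R.
have h1 := half_integral_exp kappa_gt0 d12.
have h2 := half_integral_exp k2 d12.
have h3 := half_integral_below T12.
have e80 : 0 <= e8 by exact: expR_ge0.
have e10 : 0 <= e1 by exact: expR_ge0.
have e20 : 0 <= e2 by exact: expR_ge0.
have e40 : 0 <= e4 by exact: expR_ge0.
have u10 : 0 <= u1 by exact: expR_ge0.
have u20 : 0 <= u2 by exact: expR_ge0.
have q1 := quarter_integral_scale (mulr_ge0 e80 e10) (quarter_integral_prod h1 h1).
have q2 := quarter_integral_scale (mulr_ge0 e80 e20) (quarter_integral_prod h2 h0).
have q3 := quarter_integral_scale (mulr_ge0 e80 e20) (quarter_integral_prod h0 h2).
have q4 := quarter_integral_scale (mulr_ge0 (mulr_ge0 e80 e10) u10) (quarter_integral_prod h3 h3).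
have q5 := quarter_integral_scale (mulr_ge0 (mulr_ge0 e80 e20) u20) (quarter_integral_prod h3 h0).
have q6 := quarter_integral_scale (mulr_ge0 (mulr_ge0 e80 e20) u20) (quarter_integral_prod h0 h3).
have q7 := quarter_integral_scale (mulr_ge0 e80 e40) (quarter_integral_prod h0 h0).
(* Seven nonnegative summands, as the edge and near-edge terms occur in both orientations. At each
   point it is enough that one of them dominates [G]. *)
have := quarter_integral_add q1 (quarter_integral_add q2 (quarter_integral_add q3
  (quarter_integral_add q4 (quarter_integral_add q5 (quarter_integral_add q6 q7))))).
set g := (fun z => _); set c := (X in quarter_integral _ X) => -[mg g0 gc].
rewrite unit_square_integral_quarter//.
apply: (@le_trans _ _ (4%:E * c%:E)%E).
  rewrite lee_wpmul2l// -gc; apply: le_box_integral => //.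
  move=> a b; rewrite /= !in_itv/= => a12 b12; rewrite /g /=.
  have a01 := half_unit a12; have b01 := half_unit b12.
  have /andP[a0 a1] := a12; have /andP[b0 b1] := b12.
  rewrite GE//; have [_ _ Sba] := S_sym a01 b01.
  have [_ /(_ (a, b)) /= n1 _] := q1; have [_ /(_ (a, b)) /= n2 _] := q2.
  have [_ /(_ (a, b)) /= n3 _] := q3; have [_ /(_ (a, b)) /= n4 _] := q4.
  have [_ /(_ (a, b)) /= n5 _] := q5; have [_ /(_ (a, b)) /= n6 _] := q6.
  have [_ /(_ (a, b)) /= n7 _] := q7.
  have add_ge0l (x y z : R) : 0 <= y -> x <= z -> x <= y + z.
    by move=> y0 xz; rewrite (le_trans xz)// lerDr.
  have add_ge0r (x y z : R) : 0 <= z -> x <= y -> x <= y + z.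
    by move=> z0 xy; rewrite (le_trans xy)// lerDl.
  have m6 := addr_ge0 n6 n7; have m5 := addr_ge0 n5 m6; have m4 := addr_ge0 n4 m5.
  have m3 := addr_ge0 n3 m4; have m2 := addr_ge0 n2 m3.
  (* This region is met in three of the four cases below. *)
  have corner_T : (delta < a) || (delta < b) -> a <= T -> b <= T ->
      expR (- (N * S a b)) <=
      e8 * e1 * u1 * (\1_(`[0, T]%classic : set R) a * 1 * (\1_(`[0, T]%classic : set R) b * 1)).
    move=> dab aT bT; rewrite !indic_below ?a0 ?b0// !mulr1 -!expRD ler_expR.
    rewrite -subr_ge0 (_ : _ - _ = N * (S a b - (Q + (1 - eps) * j * delta - 8 * tau)));
      last by rewrite /kappa; ring.
    by rewrite mulr_ge0 ?(ltW N_gt0)// subr_ge0 S_ge_off_corner.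
  have [ad|ad] := leP a delta; have [bd|bd] := leP b delta.
  - apply: (add_ge0r _ _ _ m2).
    rewrite !indic_below ?a0 ?b0// !mul1r -!expRD ler_expR.
    rewrite -subr_ge0 (_ : _ - _ = N * (S a b - (Q + (1 - eps) * j * a + (1 - eps) * j * b - 8 * tau)));
      last by rewrite /kappa; ring.
    by rewrite mulr_ge0 ?(ltW N_gt0)// subr_ge0 S_ge_corner.
  - apply: (add_ge0l _ _ _ n1).
    have [bT|bT] := leP b T.
      apply: (add_ge0l _ _ _ n2); apply: (add_ge0l _ _ _ n3); apply: (add_ge0r _ _ _ m5).
      by apply: corner_T; rewrite ?bd ?orbT ?(le_trans ad).
    apply: (add_ge0r _ _ _ m3).
    rewrite indic_below ?a0// !mul1r !mulr1 -!expRD ler_expR.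
    rewrite -subr_ge0 (_ : _ - _ = N * (S a b - (2 * Q + 2 * ((1 - eps) * j * a) - 8 * tau)));
      last by rewrite /kappa; ring.
    by rewrite mulr_ge0 ?(ltW N_gt0)// subr_ge0 S_ge_edge_below ?(ltW bT).
  - apply: (add_ge0l _ _ _ n1); apply: (add_ge0l _ _ _ n2).
    have [aT|aT] := leP a T.
      apply: (add_ge0l _ _ _ n3); apply: (add_ge0r _ _ _ m5).
      by apply: corner_T; rewrite ?ad ?(le_trans bd).
    apply: (add_ge0r _ _ _ m4).
    rewrite indic_below ?b0// !mul1r -!expRD ler_expR.
    rewrite -subr_ge0 (_ : _ - _ = N * (S a b - (2 * Q + 2 * ((1 - eps) * j * b) - 8 * tau)));
      last by rewrite /kappa; ring.
    by rewrite mulr_ge0 ?(ltW N_gt0)// subr_ge0 -Sba S_ge_edge_below ?(ltW aT).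
  apply: (add_ge0l _ _ _ n1); apply: (add_ge0l _ _ _ n2); apply: (add_ge0l _ _ _ n3).
  have [aT|aT] := leP a T; have [bT|bT] := leP b T.
  - by apply: (add_ge0r _ _ _ m5); apply: corner_T; rewrite ?ad.
  - apply: (add_ge0l _ _ _ n4); apply: (add_ge0r _ _ _ m6).
    rewrite indic_below ?a0// !mulr1 -!expRD ler_expR.
    rewrite -subr_ge0 (_ : _ - _ = N * (S a b - (2 * Q + 2 * ((1 - eps) * j * delta) - 8 * tau)));
      last by rewrite /kappa; ring.
    by rewrite mulr_ge0 ?(ltW N_gt0)// subr_ge0 S_ge_edge_above ?(ltW bT).
  - apply: (add_ge0l _ _ _ n4); apply: (add_ge0l _ _ _ n5); apply: (add_ge0r _ _ _ n7).
    rewrite indic_below ?b0// !mulr1 -!expRD ler_expR.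
    rewrite -subr_ge0 (_ : _ - _ = N * (S a b - (2 * Q + 2 * ((1 - eps) * j * delta) - 8 * tau)));
      last by rewrite /kappa; ring.
    by rewrite mulr_ge0 ?(ltW N_gt0)// subr_ge0 -Sba S_ge_edge_above ?(ltW aT).
  - apply: (add_ge0l _ _ _ n4); apply: (add_ge0l _ _ _ n5); apply: (add_ge0l _ _ _ n6).
    rewrite !mulr1 -!expRD ler_expR.
    rewrite -subr_ge0 (_ : _ - _ = N * (S a b - (4 * Q - 8 * tau))); last by rewrite /kappa; ring.
    by rewrite mulr_ge0 ?(ltW N_gt0)// subr_ge0 S_ge_interior ?(ltW aT) ?(ltW bT).
(* The factor 4 counts the quarters; the remaining numerical factors come from the two orientations,
   the half side length and the edge rate [2 * kappa]. The truncation factors [1 - u1] and [1 - u2]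
   are bounded by 1. *)
rewrite -EFinM lee_fin /c -/e8 -/e1 -/e2 -/e4 -/u1 -/u2.
set w := kappa^-1.
have w0 : 0 <= w by rewrite invr_ge0 ltW.
have kw : kappa ^- 2 = w * w by rewrite /w -invfM -expr2.
rewrite kw -/u1 (_ : 2 * kappa * delta = 2 * (kappa * delta)) -/u2; last by ring.
rewrite (_ : (2 * kappa)^-1 = w / 2); last by rewrite invfM mulrC.
have u11 : u1 <= 1 by rewrite /u1 expR_le1 oppr_le0 mulr_ge0 ?ltW.
have r1 : e8 * e1 * (((1 - u1) * w) * ((1 - u1) * w)) <= e8 * e1 * (w * w).
  rewrite ler_wpM2l ?mulr_ge0 ?expR_ge0// ler_pM ?mulr_ge0 ?subr_ge0//; rewrite ler_piMl//; lra.
have r2 : e8 * e2 * ((1 - u2) * (w / 2)) <= e8 * e2 * (w / 2).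
  by rewrite ler_wpM2l ?mulr_ge0 ?expR_ge0// ler_piMl ?divr_ge0//; lra.
lra.
Qed.

(** The edge strips start strictly beyond [delta], which makes them disjoint from the corner square
    and from each other, so at most one summand is nonzero at any point. The rest of the quarter is
    discarded. *)
Lemma laplace_lower_bound :
  ((4 * expR (- (N * Q)) * ((1 - expR (- (kappa' * delta))) / kappa') ^+ 2 +
    8 * expR (- (2 * (N * Q))) *
     ((1 - expR (- (2 * (N * j) * delta))) / (2 * (N * j)) * (1 / 2 - delta)))%:E
   <= \int[@leb2 R]_(z in @unit_square R) (G z)%:E)%E.
Proof.
have d12 : 0 < delta <= 1 / 2 by rewrite delta_gt0 (le_trans delta_T).
have d12' : 0 <= delta <= 1 / 2 by rewrite ltW// (le_trans delta_T).
have k2 : 0 < 2 * (N * j) by rewrite !mulr_gt0.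
pose e1 := expR (- (N * Q)).
pose e2 := expR (- (2 * (N * Q))).
have h1 := half_integral_exp kappa'_gt0 d12.
have h2 := half_integral_exp k2 d12.
have h3 := half_integral_above d12'.
have q1 := quarter_integral_scale (expR_ge0 _ : 0 <= e1) (quarter_integral_prod h1 h1).
have q2 := quarter_integral_scale (expR_ge0 _ : 0 <= e2) (quarter_integral_prod h2 h3).
have q3 := quarter_integral_scale (expR_ge0 _ : 0 <= e2) (quarter_integral_prod h3 h2).
have := quarter_integral_add q1 (quarter_integral_add q2 q3).
set g := (fun z => _); set c := (X in quarter_integral _ X) => -[mg g0 gc].
rewrite unit_square_integral_quarter//.
apply: (@le_trans _ _ (4%:E * c%:E)%E).
  rewrite -EFinM lee_fin /c -/e1 -/e2; set v := (_ / kappa'); set y := (_ / (2 * (N * j))).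
  by rewrite [in leLHS]expr2; lra.
rewrite lee_wpmul2l// -gc; apply: le_box_integral => //.
move=> a b; rewrite /= !in_itv/= => a12 b12; rewrite /g /=.
have /andP[a0 a1] := a12; have /andP[b0 b1] := b12.
have a01 : 0 <= a <= 1 by lra.
have b01 : 0 <= b <= 1 by lra.
have [ad|ad] := leP a delta; have [bd|bd] := leP b delta.
- rewrite GE//.
  rewrite !(indic_above0 ad) !(indic_above0 bd) !indic_below ?a0 ?b0// !mul0r !mulr0 !addr0 !mul1r.
  rewrite -!expRD ler_expR -subr_ge0.
  rewrite (_ : _ - _ = N * (Q + (1 + eps) * j * (a + b) - S a b)); last by rewrite /kappa'; ring.
  by rewrite mulr_ge0 ?(ltW N_gt0)// subr_ge0 S_le_corner// ?a0 ?b0.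
- rewrite GE//.
  rewrite !(indic_above0 ad) !(indic_above bd) !(indic_below0 bd) !indic_below ?a0//.
  rewrite !mul0r !mulr0 !addr0 !add0r !mul1r !mulr1.
  rewrite -!expRD ler_expR -subr_ge0.
  rewrite (_ : _ - _ = N * (2 * Q + 2 * j * a - S a b)); last by ring.
  by rewrite mulr_ge0 ?(ltW N_gt0)// subr_ge0 S_le_edge.
- rewrite GE//; have [_ _ <-] := S_sym a01 b01.
  rewrite !(indic_above0 bd) !(indic_above ad) !(indic_below0 ad) !indic_below ?b0//.
  rewrite !mul0r !mulr0 ?mul0r ?mulr0 !add0r !mul1r.
  rewrite -!expRD ler_expR -subr_ge0.
  rewrite (_ : _ - _ = N * (2 * Q + 2 * j * b - S b a)); last by ring.
  by rewrite mulr_ge0 ?(ltW N_gt0)// subr_ge0 S_le_edge.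
by rewrite !(indic_below0 ad) !(indic_below0 bd) !mul0r !mulr0 ?mul0r ?mulr0 !addr0.
Qed.

End laplace_bounds.

(** For [t > 1], the choice [k.+1 >= 6 / eta] gives [t ^+ 6 <= (t ^ eta) ^+ k.+1], and one Taylor
    term of the exponential dominates the right side. The constant depends on [eta] alone. *)
Lemma stretched_exp_le_polynomial {R : realType} (eta : R) : 0 < eta ->
  exists2 C : R, 0 < C & forall t, 0 <= t ->
    3 * eta^-1 * expR (- (eta * t `^ eta)) <= C * (1 + t) ^- 6.
Proof.
move=> eta0.
pose k := Num.truncn (6 / eta).
have k6 : 6 / eta <= k.+1%:R by rewrite ltW// truncnS_gt.
pose D := 1 + k.+1`!%:R / eta ^+ k.+1.
have D1 : 1 <= D by rewrite lerDl divr_ge0// exprn_ge0// ltW.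
exists (3 * eta^-1 * (64 * D)).
  by rewrite !mulr_gt0 ?invr_gt0// (lt_le_trans ltr01).
move=> t t0; rewrite -[leRHS]mulrA ler_wpM2l ?mulr_ge0 ?invr_ge0 ?(ltW eta0)//.
rewrite ler_pdivlMr ?exprn_gt0 ?ltr_wpDr// expRN mulrC ler_pdivrMr ?expR_gt0//.
(* The constant [64 = 2 ^+ 6] comes from [1 + t <= 2 * max(1, t)]. *)
have [t1|t1] := leP t 1.
  have h1 : (1 + t) ^+ 6 <= 64.
    rewrite (_ : 64 = 2 ^+ 6); last by rewrite -natrX.
    by rewrite ler_pXn2r ?nnegrE ?addr_ge0//; lra.
  have h2 : 1 <= expR (eta * t `^ eta).
    by rewrite -expR0 ler_expR mulr_ge0 ?powR_ge0// ltW.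
  by apply: (le_trans h1); rewrite -mulrA ler_peMr// mulr_ege1.
have h1 : (1 + t) ^+ 6 <= 64 * t ^+ 6.
  rewrite (_ : 64 = 2 ^+ 6); last by rewrite -natrX.
  by rewrite -exprMn ler_pXn2r ?nnegrE ?addr_ge0 ?mulr_ge0//; lra.
apply: (le_trans h1); rewrite -mulrA ler_wpM2l//.
set y := t `^ eta.
have y1 : 1 <= y by rewrite /y -(powRr0 t) ler_powR// ltW// ltW.
have h2 : t ^+ 6 <= y ^+ k.+1.
  rewrite -(powR_mulrn 6 t0) -(powR_mulrn k.+1 (powR_ge0 t eta)) -powRrM.
  by apply: (ler_powR (ltW t1)); rewrite mulrC -ler_pdivrMr.
apply: (le_trans h2).
have h3 := expR_ge1Dxn k (_ : 0 <= eta * y).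
have {}h3 : 1 + (eta * y) ^+ k.+1 / k.+1`!%:R <= expR (eta * y).
  by apply: h3; rewrite mulr_ge0 ?powR_ge0// ltW.
have f0 : 0 < k.+1`!%:R :> R by rewrite ltr0n fact_gt0.
have e0 : 0 < eta ^+ k.+1 by rewrite exprn_gt0.
have : y ^+ k.+1 <= k.+1`!%:R / eta ^+ k.+1 * expR (eta * y).
  rewrite -ler_pdivrMl ?divr_gt0// invf_div.
  rewrite mulrAC -exprMn; apply: le_trans h3; lra.
move=> /le_trans; apply.
by rewrite ler_wpM2r ?expR_ge0// /D; lra.
Qed.

(** * Estimates for a single connection function *)

Section radial_connection_function.
Context {R : realType}.
Variables (eta : R) (phi : R * R -> R).
Hypotheses (eta_gt0 : 0 < eta).
Hypotheses (phiP : Phi2 eta phi) (phiR : Psi2 phi).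
Local Notation mu := (@lebesgue_measure R).
Let p := conn_mu phi.
Let r := conn_rho eta phi.

Let mphi : measurable_fun [set: R * R] phi. Proof. by case: phiR => -[]. Qed.

Let phi_ge0 z : 0 <= phi z.
Proof. by case: phiR => -[_ /(_ z)/andP[]]. Qed.

Let phi_radial : forall x y, enorm2 x <= enorm2 y -> phi y <= phi x.
Proof. by case: phiR. Qed.

Lemma conn_mu_origin : p = phi (0, 0).
Proof.
apply/le_anti/andP; split.
  apply: ge_sup; first by exists (phi (0, 0)), (0, 0).
  by move=> _ [z _ <-]; exact: radial_le_max.
apply: ub_le_sup; last by exists (0, 0).
by exists 1 => _ [z _ <-]; case: phiR => -[_ /(_ z)/andP[]].
Qed.

Let rho_ext : conn_rho_ext eta phi = r%:E.
Proof.
case: phiP => _ /andP[h1 h2] _; rewrite /r /conn_rho fineK// fin_real// h2 andbT.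
exact: lt_trans h1.
Qed.

Lemma conn_rho_gt0 : 0 < r.
Proof. by case: phiP => _ /andP[+ _] _; rewrite rho_ext lte_fin. Qed.

Lemma conn_ge_below_rho z : enorm2 z < r -> eta * p <= phi z.
Proof.
move=> zr; rewrite leNgt; apply/negP => h.
have : (conn_rho_ext eta phi <= (enorm2 z)%:E)%E by apply: ereal_inf_lbound; exists z.
by rewrite rho_ext lee_fin leNgt zr.
Qed.

(** Otherwise no point would satisfy [phi x < eta * conn_mu phi], and the infimum over the empty set
    would be [+oo], against [Phi2]. *)
Lemma conn_mu_gt0 : 0 < p.
Proof.
have [h|h] := ltP 0 p => //.
case: phiP => _ /andP[_ h2] _.
suff : conn_rho_ext eta phi = +oo%E by move=> e; rewrite e in h2.
rewrite /conn_rho_ext (_ : [set x | phi x < eta * conn_mu phi] = set0).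
  by rewrite image_set0 ereal_inf0.
rewrite -subset0 => z /=; apply/negP; rewrite -leNgt (le_trans _ (phi_ge0 z))//.
by rewrite mulr_ge0_le0// ltW.
Qed.

Variable C : R.
Hypothesis C_gt0 : 0 < C.
Hypothesis C_decay : forall t, 0 <= t ->
  3 * eta^-1 * expR (- (eta * t `^ eta)) <= C * (1 + t) ^- 6.

Lemma conn_decay z : phi z <= C * p * (1 + enorm2 z / r) ^- 6.
Proof.
have r0 := conn_rho_gt0; have p0 := conn_mu_gt0.
case: phiP => _ _ /(_ z) h; apply: (le_trans h).
have E0 : 0 <= enorm2 z / r by rewrite divr_ge0 ?sqrtr_ge0// ltW.
have := C_decay E0; rewrite -(ler_pM2r p0) => h2.
rewrite mulrAC; apply: (le_trans h2).
by rewrite mulrAC.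
Qed.

Let Cp_ge0 : 0 <= C * p. Proof. by rewrite mulr_ge0 ?ltW// conn_mu_gt0. Qed.

Let tail_bound T : 0 <= T ->
  (box_integral `[0%R, +oo[ `[T, +oo[ phi <= (C * p * (pi / 2) ^+ 2 * r ^+ 2 * (1 + T / r) ^- 2)%:E)%E.
Proof.
move=> T0; apply: quadrant_tail_le => //; [exact: conn_rho_gt0|exact: conn_decay].
Qed.

Let box_fin (X Y : set R) : measurable X -> measurable Y ->
  X `<=` `[0, +oo[ -> Y `<=` `[0, +oo[ -> box_integral X Y phi \is a fin_num.
Proof.
move=> mX mY X0 Y0; rewrite ge0_fin_numE; last exact: box_integral_ge0.
apply: (@le_lt_trans _ _ (box_integral `[0%R, +oo[ `[0%R, +oo[ phi)).
  exact: box_integral_subset.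
by apply: le_lt_trans (tail_bound (lexx 0)) _; rewrite ltry.
Qed.

(** Real-valued counterparts of the box integrals; the decay of [phi] makes all of them finite, so
    [fine] loses nothing. *)
Let B a b := fine (box_integral `[0%R, a] `[0%R, b] phi).
Let A a := fine (box_integral `[0%R, a] `[0%R, +oo[ phi).
Let Q := fine (box_integral `[0%R, +oo[ `[0%R, +oo[ phi).
Let profile := (\int[mu]_(t in `[0%R, +oo[) (phi (t, 0%R))%:E)%E.
Let j := fine profile.

Let sub0 (a : R) : `[0, a] `<=` `[0, +oo[.
Proof. by move=> x /=; rewrite !in_itv/= => /andP[->]. Qed.

Let BE a b : (B a b)%:E = box_integral `[0%R, a] `[0%R, b] phi.
Proof. by rewrite /B fineK// box_fin//; exact: sub0. Qed.

Let AE a : (A a)%:E = box_integral `[0%R, a] `[0%R, +oo[ phi.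
Proof. by rewrite /A fineK// box_fin//; exact: sub0. Qed.

Let QE : Q%:E = box_integral `[0%R, +oo[ `[0%R, +oo[ phi.
Proof. by rewrite /Q fineK// box_fin. Qed.

Let jE : j%:E = profile.
Proof.
rewrite /j fineK// ge0_fin_numE; last by apply: integral_ge0 => t _; rewrite lee_fin.
apply: le_lt_trans (profile_integral_le mphi phi_ge0 Cp_ge0 conn_rho_gt0 conn_decay) _.
by rewrite ltry.
Qed.

Let B0 a b : 0 <= a -> 0 <= b -> 0 <= B a b.
Proof. by move=> _ _; apply: fine_ge0; exact: box_integral_ge0. Qed.

Let Bs a b : 0 <= a -> 0 <= b -> B a b = B b a.
Proof.
move=> _ _; rewrite /B.
by rewrite (box_integral_sym mphi phi_ge0 phi_radial (measurable_itv `[0, a]) (measurable_itv `[0, b])).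
Qed.

Let BA a b : 0 <= a -> 0 <= b -> B a b <= A a.
Proof.
move=> _ _; rewrite -lee_fin [leLHS]BE [leRHS]AE.
by apply: box_integral_subset => //; exact: sub0.
Qed.

Let Bp a b : 0 <= a -> 0 <= b -> B a b <= p * a * b.
Proof.
move=> a0 b0; rewrite -lee_fin [leLHS]BE conn_mu_origin; exact: box_integral_le_area.
Qed.

Let AQ a : 0 <= a -> A a <= Q.
Proof.
by move=> a0; rewrite -lee_fin [leLHS]AE [leRHS]QE; apply: box_integral_subset => //; exact: sub0.
Qed.

Let Am a b : 0 <= a -> a <= b -> A a <= A b.
Proof.
move=> a0 ab; rewrite -lee_fin !AE; apply: box_integral_subset => //.
by move=> x /=; rewrite !in_itv/= => /andP[-> /le_trans]; exact.
Qed.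

Let Aj a : 0 <= a -> A a <= j * a.
Proof. by move=> a0; rewrite -lee_fin AE EFinM jE; exact: strip_integral_le. Qed.

Let jA a : 0 <= a -> j * a <= A a + p * a * a.
Proof.
by move=> a0; rewrite -lee_fin EFinD AE EFinM jE conn_mu_origin; exact: strip_integral_ge.
Qed.

Let tail_subset (a b c : R) : 0 <= c -> c <= b ->
  (box_integral `[0%R, a] `[b, +oo[ phi <=
   (C * p * (pi / 2) ^+ 2 * r ^+ 2 * (1 + c / r) ^- 2)%:E)%E.
Proof.
move=> c0 cb; apply: le_trans (tail_bound c0).
apply: (box_integral_subset mphi phi_ge0) => //.
by move=> x /=; rewrite !in_itv/= !andbT; exact: le_trans.
Qed.

Let AT (c a b : R) : 0 < c -> 0 <= a -> c <= b ->
  A a <= B a b + C * p * (pi / 2) ^+ 2 * r ^+ 2 * (1 + c / r) ^- 2.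
Proof.
move=> c0 a0 cb; have b0 := le_trans (ltW c0) cb.
rewrite -lee_fin EFinD; move: (tail_subset a (ltW c0) cb) => /(leeD2l (B a b)%:E).
apply: le_trans; rewrite [leLHS]AE [X in (_ <= X + _)%E]BE.
by rewrite (box_integral_splitr mphi phi_ge0 (measurable_itv _) b0).
Qed.

Let QT (c a : R) : 0 < c -> c <= a ->
  Q <= A a + C * p * (pi / 2) ^+ 2 * r ^+ 2 * (1 + c / r) ^- 2.
Proof.
move=> c0 ca; have a0 := le_trans (ltW c0) ca.
have sub : (box_integral `[0%R, +oo[ `[a, +oo[ phi <=
    (C * p * (pi / 2) ^+ 2 * r ^+ 2 * (1 + c / r) ^- 2)%:E)%E.
  apply: le_trans (tail_bound (ltW c0)).
  apply: (box_integral_subset mphi phi_ge0) => //.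
  by move=> x /=; rewrite !in_itv/= !andbT; exact: le_trans.
rewrite -lee_fin EFinD; move: sub => /(leeD2l (A a)%:E); apply: le_trans.
rewrite [leLHS]QE [X in (_ <= X + _)%E]AE.
rewrite (box_integral_splitr mphi phi_ge0 (measurable_itv _) a0).
by rewrite (box_integral_sym mphi phi_ge0 phi_radial (measurable_itv `[0%R, +oo[) (measurable_itv `[0%R, a])).
Qed.

Let mprofile : measurable_fun [set: R] (fun t : R => phi (t, 0)).
Proof.
have mp : measurable_fun [set: R] (fun v : R => (v, 0 : R)) by exact: measurable_fun_pair.
exact: (measurableT_comp mphi mp).
Qed.

Lemma conn_IE : conn_I phi = 4 * Q.
Proof.
rewrite /conn_I /Rintegral plane_integral_quadrant// -QE -EFinM.
by [].
Qed.

Lemma conn_J1E : p * r * conn_J1 eta phi = j.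
Proof.
have p0 := conn_mu_gt0; have r0 := conn_rho_gt0.
have := jE; rewrite /profile (ge0_integral_scale (f := fun t => (phi (t, 0))%:E) r0)//; last 2 first.
- by apply/measurable_EFinP.
- by move=> t; rewrite lee_fin.
move=> /(congr1 (fun e => (r^-1)%:E * e)%E).
rewrite muleA -!EFinM mulVf ?gt_eqF// mul1e /conn_J1 /Rintegral -/p -/r => <- /=.
by field; rewrite !gt_eqF.
Qed.

(** The polar formula turns [I = 4 * Q] into [2 * pi] times the integral of [phi (t, 0) * t];
    rescaling [t] by [r] produces [r ^+ 2]. *)
Lemma conn_J2E : p * r ^+ 2 * conn_J2 eta phi = conn_I phi.
Proof.
have p0 := conn_mu_gt0; have r0 := conn_rho_gt0.
have pi0 : 0 < pi :> R := pi_gt0 R.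
have mg : measurable_fun [set: R] (fun t : R => (phi (t, 0) * `|t|)%:E).
  by apply/measurable_EFinP; apply: measurable_funM.
pose W := (\int[mu]_(t in `[0%R, +oo[) (phi (r * t, 0) * `|r * t|)%:E)%E.
have QW : (Q%:E = ((pi / 2) * r)%:E * W)%E.
  rewrite QE quadrant_integral_polar// [((pi / 2) * r)%:E]EFinM -muleA; congr (_ * _)%E.
  transitivity (\int[mu]_(t in `[0%R, +oo[) (phi (t, 0) * `|t|)%:E)%E.
    apply: eq_integral => t; rewrite inE/= in_itv/= andbT => t0.
    by rewrite ger0_norm.
  apply: (ge0_integral_scale r0 mg) => t.
  by rewrite lee_fin mulr_ge0.
have pr0 : 0 < pi / 2 * r by rewrite mulr_gt0// divr_gt0.
have {}QW : W = ((pi / 2 * r)^-1 * Q)%:E.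
  by rewrite EFinM QW muleA -EFinM mulVf ?gt_eqF// mul1e.
have YW : (\int[mu]_(t in `[0%R, +oo[) (phi (r * t, 0) * (2 * pi * t))%:E)%E
    = ((2 * pi / r)%:E * W)%E.
  rewrite /W -ge0_integralZl_EFin//; last 3 first.
  - by move=> t _; rewrite lee_fin mulr_ge0.
  - apply: measurable_funTS.
    apply: (@measurableT_comp _ _ _ _ _ _ (fun t : R => (phi (t, 0) * `|t|)%:E)) => //.
  - by rewrite divr_ge0 ?mulr_ge0 ?ltW.
  apply: eq_integral => t; rewrite inE/= in_itv/= andbT => t0.
  rewrite -EFinM; congr EFin; rewrite ger0_norm ?mulr_ge0 ?(ltW r0)//.
  by field; rewrite gt_eqF.
rewrite conn_IE /conn_J2 -/p -/r /Rintegral YW QW -EFinM /=.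
have key (a b c q : R) : a != 0 -> b != 0 -> c != 0 ->
    a * b ^+ 2 * (a^-1 * (2 * c / b * ((c / 2 * b)^-1 * q))) = 4 * q.
  move=> a0 b0 c0; field.
  by rewrite a0 b0 c0.
by apply: key; rewrite gt_eqF.
Qed.

Lemma conn_J1_bounds : eta <= conn_J1 eta phi <= C * (pi / 2).
Proof.
have p0 := conn_mu_gt0; have r0 := conn_rho_gt0.
have pr0 : 0 < p * r by rewrite mulr_gt0.
have h1 : eta * p * r <= j.
  rewrite -lee_fin jE; apply: profile_integral_ge => //.
    by rewrite mulr_ge0// ltW.
  exact: conn_ge_below_rho.
have h2 : j <= C * p * (r * (pi / 2)).
  by rewrite -lee_fin jE; apply: profile_integral_le => //; exact: conn_decay.
rewrite -conn_J1E in h1 h2.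
by apply/andP; split; rewrite -(ler_pM2l pr0); lra.
Qed.

(** From below, the square of side [r / 2] lies within distance [r] of the origin, where
    [phi >= eta * p], and its area [r ^+ 2 / 4] cancels the 4 of [I = 4 * Q]. From above, the tail
    estimate is used at [T = 0]. *)
Lemma conn_J2_bounds : eta <= conn_J2 eta phi <= 4 * C * (pi / 2) ^+ 2.
Proof.
have p0 := conn_mu_gt0; have r0 := conn_rho_gt0.
have pr0 : 0 < p * r ^+ 2 by rewrite mulr_gt0// exprn_gt0.
have h1 : eta * p * (r / 2) * (r / 2) <= Q.
  rewrite -lee_fin QE; apply: (@le_trans _ _ (box_integral `[0%R, r / 2] `[0%R, r / 2] phi)).
    have r20 : 0 <= r / 2 by rewrite divr_ge0// ltW.
    apply: box_integral_ge_area => //; first by rewrite mulr_ge0// ltW.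
    apply: conn_ge_below_rho; rewrite /enorm2/= -(@ltr_pXn2r _ 2)// ?nnegrE ?sqrtr_ge0 ?(ltW r0)//.
    rewrite sqr_sqrtr ?addr_ge0 ?sqr_ge0//; nra.
  by apply: box_integral_subset => //; exact: sub0.
have h2 : Q <= C * p * (pi / 2) ^+ 2 * r ^+ 2 * (1 + 0 / r) ^- 2.
  by rewrite -lee_fin QE tail_bound.
rewrite mul0r addr0 expr1n invr1 mulr1 in h2.
have := conn_J2E; rewrite conn_IE => h3.
apply/andP; split; rewrite -(ler_pM2l pr0) h3; lra.
Qed.

Let unit_square_integralE a b : 0 <= a <= 1 -> 0 <= b <= 1 ->
  (\int[@leb2 R]_(y in @unit_square R) phi (y - (a, b))) =
  B a b + B a (1 - b) + (B (1 - a) b + B (1 - a) (1 - b)).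
Proof.
move=> a01 b01; rewrite /Rintegral box_integral_shift//; last 2 first.
- by move=> x y; apply: radial_eq => //; rewrite sqrrN.
- by move=> x y; apply: radial_eq => //; rewrite sqrrN.
by rewrite -!BE -!EFinD.
Qed.

(** The two coordinates of [y] are integrated one after the other, with [x] kept as a parameter
    throughout. *)
Let measurable_shift_integral : measurable_fun [set: R * R]
  (fun x => \int[@leb2 R]_(y in @unit_square R) phi (y - x)).
Proof.
pose K (z : (R * R) * R * R) := (phi (z.1.2 - z.1.1.1, z.2 - z.1.1.2))%:E.
have mK : measurable_fun setT K.
  apply/measurable_EFinP; apply: measurableT_comp => //.
  apply: measurable_fun_pair; apply: measurable_funB.
  - exact: (measurableT_comp measurable_snd measurable_fst).
  - apply: (measurableT_comp measurable_fst).
    exact: (measurableT_comp measurable_fst measurable_fst).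
  - exact: measurable_snd.
  - apply: (measurableT_comp measurable_snd).
    exact: (measurableT_comp measurable_fst measurable_fst).
have K0 z : (0 <= K z)%E by rewrite lee_fin.
have mL := measurable_param_integral (measurable_itv `[0, 1]) mK K0.
have L0 z : (0 <= \int[mu]_(y in `[0%R, 1%R]) K (z, y))%E by apply: integral_ge0.
have mM := measurable_param_integral (measurable_itv `[0, 1]) mL L0.
apply: measurableT_comp => //.
congr (measurable_fun _ _) : mM; apply/funext => x /=.
have mx : measurable_fun [set: R * R] (fun y : R * R => (phi (y - x))%:E).
  apply/measurable_EFinP; apply: measurableT_comp => //.
  rewrite (_ : (fun _ => _) = fun z : R * R => (z.1 - x.1, z.2 - x.2)).
    by apply/measurable_fun_pair; [exact: measurable_funB|exact: measurable_funB].
  by apply/funext => -[? ?]; case: (x).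
rewrite /unit_square
  (@ge0_integral_setX _ _ _ (fun y => (phi (y - x))%:E))//; last by move=> z; rewrite lee_fin.
Qed.

Variables (N T eps : R).
Hypotheses (N_gt0 : 0 < N) (eps_gt0 : 0 < eps) (eps_lt1 : eps < 1).
(** The factor [eta] is the lower bound on [J1]: it yields [p * delta <= eps * (p * r * J1)], the
    smallness required by the Laplace bounds. *)
Let delta := eps * eta * r.
Hypotheses (delta_T : delta <= T) (T_half : T <= 1 / 2).
Let tau := C * p * (pi / 2) ^+ 2 * r ^+ 2 * (1 + T / r) ^- 2.
Let J1 := conn_J1 eta phi.
Let I := conn_I phi.

Lemma conn_integral_bounds :
  let kappa := N * ((1 - eps) * (p * r * J1)) in
  let kappa' := N * ((1 + eps) * (p * r * J1)) in
  let F := \int[@leb2 R]_(x in @unit_square R)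
     expR (- (N * \int[@leb2 R]_(y in @unit_square R) phi (y - x))) in
  (4 * expR (- (N * (I / 4))) * ((1 - expR (- (kappa' * delta))) / kappa') ^+ 2 +
    8 * expR (- (2 * (N * (I / 4)))) *
     ((1 - expR (- (2 * (N * (p * r * J1)) * delta))) / (2 * (N * (p * r * J1)))
        * (1 / 2 - delta)) <= F /\
  F <= expR (8 * (N * tau)) * (4 * expR (- (N * (I / 4))) / kappa ^+ 2 +
     2 * expR (- (2 * (N * (I / 4)))) / kappa +
     4 * expR (- (N * (I / 4))) * expR (- (kappa * delta)) * T ^+ 2 +
     4 * expR (- (2 * (N * (I / 4)))) * expR (- (2 * (kappa * delta))) * T +
     expR (- (4 * (N * (I / 4)))))).
Proof.
move=> kappa kappa' F.
have p0 := conn_mu_gt0; have r0 := conn_rho_gt0.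
have /andP[J1l _] := conn_J1_bounds.
have J10 : 0 < J1 by exact: lt_le_trans J1l.
have IQ : I / 4 = Q by rewrite /I conn_IE; field.
have jJ := conn_J1E; rewrite -/J1 in jJ.
have j0 : 0 < j by rewrite -jJ mulr_gt0// mulr_gt0.
have d0 : 0 < delta by rewrite mulr_gt0// mulr_gt0.
have T0 : 0 < T by exact: lt_le_trans delta_T.
pose G (z : R * R) := expR (- (N * \int[@leb2 R]_(y in @unit_square R) phi (y - z))).
have mG : measurable_fun [set: R * R] G.
  have mh : measurable_fun [set: R * R]
      (fun z : R * R => N * \int[@leb2 R]_(y in @unit_square R) phi (y - z)).
    by apply: measurable_funM => //; exact: measurable_shift_integral.
  by apply: measurableT_comp => //; exact: measurableT_comp.
have G0 z : 0 <= G z by exact: expR_ge0.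
have GE a b : 0 <= a <= 1 -> 0 <= b <= 1 -> G (a, b) =
    expR (- (N * (B a b + B a (1 - b) + (B (1 - a) b + B (1 - a) (1 - b))))).
  by move=> a01 b01; rewrite /G unit_square_integralE.
have pd : p * delta <= eps * j.
  rewrite -jJ /delta (_ : p * _ = eps * (p * r * eta)); last by ring.
  by rewrite ler_pM2l// ler_pM2l ?mulr_gt0.
have U := laplace_upper_bound N_gt0 j0 (ltW p0) eps_lt1 d0 delta_T T_half pd
  B0 Bs BA AQ Am jA (fun a b => @AT T a b T0) (fun a => @QT T a T0) mG G0 GE.
have V := laplace_lower_bound N_gt0 j0 (ltW p0) eps_gt0 d0 delta_T T_half pd
  Bs BA Bp AQ Aj mG G0 GE.
have Ffin : (\int[@leb2 R]_(z in @unit_square R) (G z)%:E)%E \is a fin_num.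
  rewrite ge0_fin_numE; last by apply: integral_ge0 => z _; rewrite lee_fin.
  by apply: le_lt_trans U _; rewrite ltry.
have FE : F%:E = (\int[@leb2 R]_(z in @unit_square R) (G z)%:E)%E.
  by rewrite /F /Rintegral fineK.
by rewrite -FE !lee_fin -IQ -jJ in U V.
Qed.

End radial_connection_function.

(** * Limits of real sequences *)

Section real_sequences.
Context {R : realType}.
Implicit Types u v : nat -> R.

Lemma cvg_near_eq u v (l : R) : (\forall n \near \oo, u n = v n) ->
  v n @[n --> \oo] --> l -> u n @[n --> \oo] --> l.
Proof.
move=> uv vl; apply/cvgrPdist_le => e e0.
move/cvgrPdist_le : vl => /(_ e e0) h.
by apply: filterS2 uv h => n ->.
Qed.

Lemma cvg0_bounded_mul (M : R) u v : (\forall n \near \oo, `|u n| <= M) ->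
  v n @[n --> \oo] --> (0 : R) -> u n * v n @[n --> \oo] --> (0 : R).
Proof.
move=> uM v0; apply/norm_cvg0P.
apply: (@squeeze_cvgr _ _ _ _ (fun=> 0) (fun n => M * `|v n|)).
- apply: filterS uM => n uM; rewrite normr_ge0 normrM.
  by rewrite ler_wpM2r.
- exact: cvg_cst.
- rewrite -[X in _ --> X](mulr0 M); apply: cvgMr.
  by apply/norm_cvg0P.
Qed.

Lemma pinfty_inv u : u n @[n --> \oo] --> +oo -> (u n)^-1 @[n --> \oo] --> (0 : R).
Proof.
move=> uy; apply/gtr0_cvgV0 => //.
by move/cvgryPgt : uy; exact.
Qed.

Lemma pinfty_scale (k : R) u : 0 < k -> u n @[n --> \oo] --> +oo ->
  k * u n @[n --> \oo] --> +oo.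
Proof.
move=> k0 /cvgryPge uy; apply/cvgryPge => A.
by apply: filterS (uy (A / k)) => n; rewrite ler_pdivrMr// mulrC.
Qed.

Lemma pinfty_sqrt u : u n @[n --> \oo] --> +oo ->
  Num.sqrt (u n) @[n --> \oo] --> +oo.
Proof.
move=> /cvgryPge uy; apply/cvgryPge => A.
apply: filterS (uy (A ^+ 2)) => n h.
by apply: le_trans (ler_norm A) _; rewrite -sqrtr_sqr ler_wsqrtr.
Qed.

Lemma pinfty_ln : ln (n%:R : R) @[n --> \oo] --> +oo.
Proof.
apply/cvgryPge => A; apply: filterS (nbhs_infty_ger (expR A)) => n h.
by rewrite -[A]expRK ler_ln// posrE ?expR_gt0// (lt_le_trans (expR_gt0 A)).
Qed.

(** The bound is [ln u = 2 * ln (sqrt u) <= 2 * sqrt u]. *)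
Lemma ln_div_cvg0 u : u n @[n --> \oo] --> +oo ->
  ln (u n) / u n @[n --> \oo] --> (0 : R).
Proof.
move=> uy.
apply: (@squeeze_cvgr _ _ _ _ (fun=> 0) (fun n => 2 * (Num.sqrt (u n))^-1)).
- move/cvgryPge : (uy) => /(_ 1); apply: filterS => n u1.
  have u0 : 0 < u n by exact: lt_le_trans u1.
  have s0 : 0 < Num.sqrt (u n) by rewrite sqrtr_gt0.
  rewrite divr_ge0 ?ln_ge0//= ?(ltW u0)// ler_pdivrMr//.
  have ue : u n = Num.sqrt (u n) ^+ 2 by rewrite sqr_sqrtr// ltW.
  move: (Num.sqrt (u n)) s0 ue => x x0 ->.
  rewrite lnXn// (_ : 2 * x^-1 * x ^+ 2 = 2 * x); last by field; rewrite gt_eqF.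
  by rewrite mulr2n; have := ln_sublinear x0; lra.
- exact: cvg_cst.
- rewrite -[X in _ --> X](mulr0 2); apply: cvgMr.
  by apply: pinfty_inv; exact: pinfty_sqrt.
Qed.

Lemma exp_decay_cvg0 (a : R) (k : nat) u : 0 < a -> u n @[n --> \oo] --> +oo ->
  u n ^+ k * expR (- (a * u n)) @[n --> \oo] --> (0 : R).
Proof.
move=> a0 uy; pose D := k.+1`!%:R / a ^+ k.+1.
apply: (@squeeze_cvgr _ _ _ _ (fun=> 0) (fun n => D * (u n)^-1)).
- move/cvgryPge : (uy) => /(_ 1); apply: filterS => n u1.
  have u0 : 0 < u n by exact: lt_le_trans u1.
  rewrite mulr_ge0 ?expR_ge0 ?exprn_ge0 ?(ltW u0)//=.
  rewrite expRN ler_pdivrMr ?expR_gt0//.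
  have au : 0 <= a * u n by rewrite mulr_ge0// ltW.
  have h := expR_ge1Dxn k au.
  have f0 : 0 < k.+1`!%:R :> R by rewrite ltr0n fact_gt0.
  have D0 : 0 < D by rewrite divr_gt0// exprn_gt0.
  have : D * (u n)^-1 * ((a * u n) ^+ k.+1 / k.+1`!%:R) <= D * (u n)^-1 * expR (a * u n).
    have Du0 : 0 <= D * (u n)^-1 by rewrite ltW// divr_gt0.
    rewrite ler_wpM2l//.
    by apply: le_trans h; rewrite lerDr.
  apply: le_trans; rewrite le_eqVlt; apply/orP; left; apply/eqP.
  have key (A f x y : R) : A != 0 -> f != 0 -> x != 0 ->
      y = f / A * x^-1 * (A * (x * y) / f).
    by move=> A0 h0 x0; field; rewrite A0 h0 x0.
  by rewrite exprMn [u n ^+ k.+1]exprS; apply: key; rewrite gt_eqF// exprn_gt0.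
- exact: cvg_cst.
- by rewrite -[X in _ --> X](mulr0 D); apply: cvgMr; exact: pinfty_inv.
Qed.

Lemma expRN_cvg0 u : u n @[n --> \oo] --> +oo ->
  expR (- u n) @[n --> \oo] --> (0 : R).
Proof.
move=> uy; apply: (cvg_near_eq _ (exp_decay_cvg0 0 ltr01 uy)).
by apply: nearW => n; rewrite expr0 !mul1r.
Qed.

(** The weights may oscillate. Being nonnegative with constant sum they are bounded, so the errors
    [a n - 1] and [b n - 1] vanish after weighting. *)
Lemma cvg_convex_mix (alpha : R) u v a b :
  (\forall n \near \oo, [/\ 0 <= u n, 0 <= v n & u n + v n = alpha]) ->
  a n @[n --> \oo] --> (1 : R) -> b n @[n --> \oo] --> (1 : R) ->
  u n * a n + v n * b n @[n --> \oo] --> alpha.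
Proof.
move=> uv a1 b1.
have e : \forall n \near \oo, u n * a n + v n * b n =
    alpha + (u n * (a n - 1) + v n * (b n - 1)).
  by apply: filterS uv => n [_ _ <-]; ring.
apply: (cvg_near_eq e); rewrite -[X in _ --> X]addr0; apply: cvgD; first exact: cvg_cst.
rewrite -[X in _ --> X]addr0; apply: cvgD; apply: (@cvg0_bounded_mul alpha).
- by apply: filterS uv => n [u0 v0 <-]; rewrite ger0_norm// lerDl.
- by rewrite -(subrr 1); apply: cvgB => //; exact: cvg_cst.
- by apply: filterS uv => n [u0 v0 <-]; rewrite ger0_norm// lerDr.
- by rewrite -(subrr 1); apply: cvgB => //; exact: cvg_cst.
Qed.

Lemma cvg_ln u (l : R) : 0 < l -> u n @[n --> \oo] --> l -> ln (u n) @[n --> \oo] --> ln l.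
Proof. by move=> l0 ul; apply: continuous_cvg ul; exact: continuous_ln. Qed.

Lemma cvg_expR u (l : R) : u n @[n --> \oo] --> l -> expR (u n) @[n --> \oo] --> expR l.
Proof. by move=> ul; apply: continuous_cvg ul; exact: continuous_expR. Qed.

Lemma cvg_sqr u (l : R) : u n @[n --> \oo] --> l -> u n ^+ 2 @[n --> \oo] --> l ^+ 2.
Proof.
move=> ul; rewrite expr2.
by apply: (@cvg_near_eq _ (fun n => u n * u n)); [exact: nearW|exact: cvgM].
Qed.

End real_sequences.

(** * Asymptotics of the corner, edge and error terms *)

Section isolated_vertices_asymptotics.
Context {R : realType}.
Variables (alpha eta C K1 K2 c1 c2 c : R).
Variables (p r beta I J1 J2 F : nat -> R).
Hypotheses (alpha_gt0 : 0 < alpha) (eta_gt0 : 0 < eta).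
Hypotheses (c1_gt0 : 0 < c1) (c2_gt0 : 0 < c2) (c_gt0 : 0 < c).
Let l n := ln (n%:R : R).
Let W n := n%:R `^ (1 / 3) * p n * l n.
Let X n := (3 * J2 n) `^ (- (3 / 2)) * J1 n ^+ 3 * W n `^ (3 / 2).
Let L n := ln (1 / p n).
Let G n := ln (J2 n / (beta n * J1 n ^+ 2)).
Let o n := n%:R * I n - 4 * (L n - ln (L n) + G n).
Hypothesis p_gt0 : forall n, (0 < n)%N -> 0 < p n.
Hypothesis r_gt0 : forall n, (0 < n)%N -> 0 < r n.
Hypothesis IE : forall n, (0 < n)%N -> p n * r n ^+ 2 * J2 n = I n.
Hypothesis J1_bounds : forall n, (0 < n)%N -> eta <= J1 n <= K1.
Hypothesis J2_bounds : forall n, (0 < n)%N -> eta <= J2 n <= K2.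
Hypothesis beta_eq : forall n, (0 < n)%N ->
  0 < beta n /\ X n * beta n ^+ 2 + beta n = alpha.
Hypothesis p_bounds : \forall n \near \oo,
  c1 * (n%:R `^ (- (1 / 3)) * (l n)^-1) <= p n <= c2 * (n%:R `^ (- (1 / 3)) * (l n)^-1).
Hypothesis r_le : \forall n \near \oo, r n <= n%:R `^ (- c).
Hypothesis o_cvg0 : o n @[n --> \oo] --> (0 : R).
Let tau n T := C * p n * (pi / 2) ^+ 2 * r n ^+ 2 * (1 + T / r n) ^- 2.
Let j n := p n * r n * J1 n.
Let lower n (eps : R) :=
  let delta := eps * eta * r n in
  4 * expR (- (n%:R * (I n / 4))) *
    ((1 - expR (- (n%:R * ((1 + eps) * j n) * delta))) / (n%:R * ((1 + eps) * j n))) ^+ 2 +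
  8 * expR (- (2 * (n%:R * (I n / 4)))) *
    ((1 - expR (- (2 * (n%:R * j n) * delta))) / (2 * (n%:R * j n)) * (1 / 2 - delta)).
Let upper n (eps T : R) :=
  let kappa := n%:R * ((1 - eps) * j n) in
  let delta := eps * eta * r n in
  expR (8 * (n%:R * tau n T)) * (4 * expR (- (n%:R * (I n / 4))) / kappa ^+ 2 +
     2 * expR (- (2 * (n%:R * (I n / 4)))) / kappa +
     4 * expR (- (n%:R * (I n / 4))) * expR (- (kappa * delta)) * T ^+ 2 +
     4 * expR (- (2 * (n%:R * (I n / 4)))) * expR (- (2 * (kappa * delta))) * T +
     expR (- (4 * (n%:R * (I n / 4))))).
Hypothesis F_bounds : forall n (eps T : R), (0 < n)%N -> 0 < eps -> eps < 1 ->
  eps * eta * r n <= T -> T <= 1 / 2 -> lower n eps <= F n /\ F n <= upper n eps T.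

Let l_pinfty : l n @[n --> \oo] --> +oo := @pinfty_ln R.

Let good : \forall n \near \oo, [/\ (0 < n)%N, 1 <= l n & c1 <= W n <= c2].
Proof.
have h := (cvgryPge _).1 l_pinfty 1.
near=> n.
have n0 : (0 < n)%N by near: n; exact: nbhs_infty_gt.
have l1 : 1 <= l n by near: n; exact: h.
have /andP[pl pu] : c1 * (n%:R `^ (- (1 / 3)) * (l n)^-1) <= p n <=
  c2 * (n%:R `^ (- (1 / 3)) * (l n)^-1) by near: n; exact: p_bounds.
split => //.
have l0 : 0 < l n by exact: lt_le_trans l1.
have n0' : 0 < n%:R :> R by rewrite ltr0n.
have q0 : 0 < n%:R `^ (1 / 3) :> R by rewrite powR_gt0.
have pe d : d = n%:R `^ (1 / 3) * (d * (n%:R `^ (- (1 / 3)) * (l n)^-1)) * l n.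
  by rewrite powRN; field; rewrite !gt_eqF.
rewrite /W {1}(pe c1) {1}(pe c2).
by rewrite !ler_pM2r// !ler_pM2l// pl pu.
Unshelve. all: by end_near. Qed.

Let D := `|ln c1| + `|ln c2|.

Let lnW_bounded : \forall n \near \oo, `|ln (W n)| <= D.
Proof.
apply: filterS good => n [n0 l1 /andP[W1 W2]].
have W0 : 0 < W n by exact: lt_le_trans W1.
have h1 : ln c1 <= ln (W n) by rewrite ler_ln.
have h2 : ln (W n) <= ln c2 by rewrite ler_ln.
rewrite ler_norml /D; have := ler_norm (ln c2); have := ler_norm (- ln c1); rewrite normrN.
have := normr_ge0 (ln c1); have := normr_ge0 (ln c2); lra.
Qed.

Let lnW n : (0 < n)%N -> 1 <= l n -> ln (W n) = l n / 3 - L n + ln (l n).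
Proof.
move=> n0 l1.
have l0 : 0 < l n by exact: lt_le_trans l1.
have n0' : 0 < n%:R :> R by rewrite ltr0n.
have p0 := p_gt0 n0.
have -> : L n = - ln (p n) by rewrite /L div1r lnV// posrE.
rewrite /W !lnM ?posrE ?mulr_gt0 ?powR_gt0// ln_powR.
by rewrite -/(l n); lra.
Qed.

(** By [lnW], [L] equals [l / 3 + ln l] up to the bounded term [ln W]. *)
Let L_div_l : L n / l n @[n --> \oo] --> (1 / 3 : R).
Proof.
have e : \forall n \near \oo, L n / l n =
    1 / 3 + (ln (l n) / l n - ln (W n) * (l n)^-1).
  apply: filterS good => n [n0 l1 _].
  have l0 : 0 < l n by exact: lt_le_trans l1.
  rewrite (lnW n0 l1); field; by rewrite gt_eqF.
apply: (cvg_near_eq e); rewrite -[X in _ --> X]addr0; apply: cvgD; first exact: cvg_cst.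
rewrite -[X in _ --> X](subrr 0); apply: cvgB; first exact: ln_div_cvg0.
apply: (cvg0_bounded_mul lnW_bounded); exact: pinfty_inv.
Qed.

Let L_pinfty : L n @[n --> \oo] --> +oo.
Proof.
apply: (ger_cvgy (f := fun n => 1 / 6 * l n)); last by apply: pinfty_scale => //; lra.
have h : \forall n \near \oo, 1 / 6 <= L n / l n by apply: (cvgr_ge _ L_div_l); lra.
apply: filterS2 good h => n [n0 l1 _].
by rewrite ler_pdivlMr// (lt_le_trans _ l1).
Qed.

Let X0 := (3 * eta) `^ (- (3 / 2)) * K1 ^+ 3 * c2 `^ (3 / 2).

Let X_bounds : \forall n \near \oo, 0 < X n <= X0.
Proof.
apply: filterS good => n [n0 l1 /andP[W1 W2]].
have /andP[a1 a2] := J1_bounds n0; have /andP[b1 b2] := J2_bounds n0.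
have J10 : 0 < J1 n by exact: lt_le_trans a1.
have J20 : 0 < J2 n by exact: lt_le_trans b1.
have W0 : 0 < W n by exact: lt_le_trans W1.
apply/andP; split.
  by rewrite /X mulr_gt0 ?powR_gt0// mulr_gt0 ?exprn_gt0 ?powR_gt0// mulr_gt0.
rewrite /X /X0; apply: ler_pM; rewrite ?powR_ge0 ?mulr_ge0 ?powR_ge0 ?exprn_ge0 ?(ltW J10)//.
  apply: ler_pM; rewrite ?powR_ge0 ?exprn_ge0 ?(ltW J10)//.
    rewrite !powRN lef_pV2 ?posrE ?powR_gt0 ?mulr_gt0//.
    apply: ge0_ler_powR; rewrite ?nnegrE ?mulr_ge0 ?(ltW eta_gt0) ?(ltW J20)//; lra.
  by rewrite ler_pXn2r// nnegrE ?(ltW J10)// (le_trans _ a2)// ltW.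
by apply: ge0_ler_powR; rewrite ?nnegrE ?(ltW W0) ?(ltW c2_gt0)//; lra.
Qed.

Let weights : \forall n \near \oo,
  [/\ 0 <= beta n, 0 <= X n * beta n ^+ 2 & beta n + X n * beta n ^+ 2 = alpha].
Proof.
apply: filterS2 good X_bounds => n [n0 _ _] /andP[X1 X2].
have [b0 be] := beta_eq n0.
by split; [exact: ltW|rewrite mulr_ge0 ?exprn_ge0 ?ltW|rewrite addrC].
Qed.

Let G_bounded : exists M, \forall n \near \oo, `|G n| <= M.
Proof.
(* A lower bound on [beta]: since [beta <= alpha], the quadratic term is at most
   [X0 * alpha * beta], hence [alpha <= (1 + alpha * X0) * beta]. *)
pose b0 := alpha / (1 + alpha * X0).
exists (`|ln eta| + `|ln K2| + (`|ln b0| + `|ln alpha| + 2 * (`|ln eta| + `|ln K1|))).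
apply: filterS3 good X_bounds weights => n [n0 l1 _] /andP[X1 X2] [bn0 bx0 be].
have [b_gt0 _] := beta_eq n0.
have /andP[a1 a2] := J1_bounds n0; have /andP[d1 d2] := J2_bounds n0.
have J10 : 0 < J1 n by exact: lt_le_trans a1.
have J20 : 0 < J2 n by exact: lt_le_trans d1.
have X00 : 0 < X0 by exact: lt_le_trans X2.
have bb : b0 <= beta n.
  rewrite /b0 ler_pdivrMr; last by rewrite addr_gt0// mulr_gt0.
  have ba : beta n <= alpha by lra.
  have : X n * beta n ^+ 2 <= X0 * (alpha * beta n).
    apply: ler_pM => //; rewrite ?(ltW X1) ?sqr_ge0// expr2 ler_pM2r//.
  by lra.
have b00 : 0 < b0 by rewrite divr_gt0// addr_gt0// mulr_gt0.
have lnb (x y z : R) : 0 < x -> x <= y -> y <= z -> `|ln y| <= `|ln x| + `|ln z|.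
  move=> x0 xy yz; have y0 := lt_le_trans x0 xy; have z0 := lt_le_trans y0 yz.
  have h1 : ln x <= ln y by rewrite ler_ln.
  have h2 : ln y <= ln z by rewrite ler_ln.
  rewrite ler_norml; have := ler_norm (ln z); have := ler_norm (- ln x); rewrite normrN.
  have := normr_ge0 (ln x); have := normr_ge0 (ln z); lra.
have g1 := lnb _ _ _ eta_gt0 d1 d2; have g2 := lnb _ _ _ eta_gt0 a1 a2.
have g3 : `|ln (beta n)| <= `|ln b0| + `|ln alpha| by apply: lnb => //; lra.
have -> : G n = ln (J2 n) - (ln (beta n) + 2 * ln (J1 n)).
  rewrite /G ln_div ?posrE ?mulr_gt0 ?exprn_gt0// lnM ?posrE ?exprn_gt0// lnXn//.
  by rewrite mulr_natl.
apply: (le_trans (ler_normB _ _)); apply: lerD => //.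
apply: (le_trans (ler_normD _ _)); apply: lerD => //.
by rewrite normrM ger0_norm// ler_pM2l.
Qed.

(** The corrections [ln L], [G] and [o] are all negligible against [L], since [G] is bounded. *)
Let nI_div_L : n%:R * I n / L n @[n --> \oo] --> (4 : R).
Proof.
have [M GM] := G_bounded.
have e : \forall n \near \oo, n%:R * I n / L n =
    4 + (4 * (G n * (L n)^-1 - ln (L n) / L n) + o n * (L n)^-1).
  apply: filterS ((cvgryPge _).1 L_pinfty 1) => n L1.
  by rewrite /o; field; rewrite gt_eqF// (lt_le_trans _ L1).
apply: (cvg_near_eq e); rewrite -[X in _ --> X]addr0; apply: cvgD; first exact: cvg_cst.
have iL := pinfty_inv L_pinfty.
rewrite -[X in _ --> X]addr0; apply: cvgD.
  rewrite -[X in _ --> X](mulr0 4); apply: cvgMr.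
  rewrite -[X in _ --> X](subrr 0); apply: cvgB; last exact: ln_div_cvg0.
  exact: (cvg0_bounded_mul GM).
by rewrite -[X in _ --> X](mulr0 0); apply: cvgM.
Qed.

Let nI_pinfty : n%:R * I n @[n --> \oo] --> +oo.
Proof.
apply: (ger_cvgy (f := fun n => 1 * L n)); last by apply: pinfty_scale.
have h : \forall n \near \oo, 1 <= n%:R * I n / L n by apply: (cvgr_ge _ nI_div_L); lra.
apply: filterS2 ((cvgryPge _).1 L_pinfty 1) h => n L1.
by rewrite ler_pdivlMr// (lt_le_trans _ L1).
Qed.

Let nI_div_l : n%:R * I n / l n @[n --> \oo] --> (4 / 3 : R).
Proof.
have e : \forall n \near \oo, n%:R * I n / l n = (n%:R * I n / L n) * (L n / l n).
  apply: filterS2 ((cvgryPge _).1 L_pinfty 1) good => n L1 [_ l1 _].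
  by field; rewrite !gt_eqF// ?(lt_le_trans _ L1)// (lt_le_trans _ l1).
apply: (cvg_near_eq e); rewrite (_ : 4 / 3 = 4 * (1 / 3)); last by field.
exact: cvgM.
Qed.

Let lnL_l : ln (L n) - ln (l n) + ln 3 @[n --> \oo] --> (0 : R).
Proof.
have e : \forall n \near \oo, ln (L n) - ln (l n) + ln 3 = ln (L n / l n) + ln 3.
  apply: filterS2 ((cvgryPge _).1 L_pinfty 1) good => n L1 [_ l1 _].
  by rewrite ln_div// posrE ?(lt_le_trans _ L1)// (lt_le_trans _ l1).
apply: (cvg_near_eq e).
rewrite (_ : 0 = ln (1 / 3) + ln 3 :> R); last first.
  by rewrite div1r lnV ?posrE// addNr.
by apply: cvgD; [apply: cvg_ln L_div_l; lra|exact: cvg_cst].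
Qed.

Let lnnI_L : ln (n%:R * I n) - ln (L n) - ln 4 @[n --> \oo] --> (0 : R).
Proof.
have e : \forall n \near \oo, ln (n%:R * I n) - ln (L n) - ln 4 = ln (n%:R * I n / L n) - ln 4.
  apply: filterS2 ((cvgryPge _).1 L_pinfty 1) ((cvgryPge _).1 nI_pinfty 1) => n L1 I1.
  by rewrite ln_div// posrE ?(lt_le_trans _ L1)// (lt_le_trans _ I1).
apply: (cvg_near_eq e); rewrite -(subrr (ln 4)).
by apply: cvgB; [apply: cvg_ln nI_div_L; lra|exact: cvg_cst].
Qed.

(* The ratios of the corner and edge contributions to [beta n] and
   [X n * beta n ^+ 2], see [main_term]. *)
Let cr n := expR (- (ln (n%:R * I n) - ln (L n) - ln 4) - o n / 4).
Let er n := expR (3 / 2 * (ln (L n) - ln (l n) + ln 3)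
  - 1 / 2 * (ln (n%:R * I n) - ln (L n) - ln 4) - o n / 2).

Let cr_cvg1 : cr n @[n --> \oo] --> (1 : R).
Proof.
rewrite -expR0; apply: cvg_expR; rewrite (_ : 0 = - 0 - 0 / 4 :> R); last by field.
by apply: cvgB; [exact: cvgN|exact: cvgMl].
Qed.

Let er_cvg1 : er n @[n --> \oo] --> (1 : R).
Proof.
rewrite -expR0; apply: cvg_expR.
rewrite (_ : 0 = 3 / 2 * 0 - 1 / 2 * 0 - 0 / 2 :> R); last by field.
by apply: cvgB; [apply: cvgB; exact: cvgMr|exact: cvgMl].
Qed.

(* [lam] is the large parameter of the Laplace integrals at scale [r]; the
   cutoffs below are [eps = lam^(-1/2)] and [T = lam * r]. *)
Let lam n := n%:R * p n * r n ^+ 2.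
Let s n := Num.sqrt (lam n).

Let lamE n : (0 < n)%N -> lam n * J2 n = n%:R * I n.
Proof. by move=> n0; rewrite -IE// /lam; ring. Qed.

Let lam_gt0 n : (0 < n)%N -> 0 < lam n.
Proof.
move=> n0; have n0' : 0 < n%:R :> R by rewrite ltr0n.
by rewrite mulr_gt0 ?exprn_gt0 ?r_gt0// mulr_gt0 ?p_gt0.
Qed.

Let positive : \forall n \near \oo, (0 < n)%N := nbhs_infty_gt 0%N.

Let J_gt0 n : (0 < n)%N -> [/\ 0 < J1 n, 0 < J2 n & 0 < j n].
Proof.
move=> n0; have /andP[a1 _] := J1_bounds n0; have /andP[b1 _] := J2_bounds n0.
have J10 := lt_le_trans eta_gt0 a1; have J20 := lt_le_trans eta_gt0 b1.
by split => //; rewrite /j mulr_gt0// mulr_gt0 ?p_gt0 ?r_gt0.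
Qed.

Let lam_pinfty : lam n @[n --> \oo] --> +oo.
Proof.
have K20 : 0 < K2.
  have /andP[h1 h2] := J2_bounds (ltn0Sn 0).
  exact: lt_le_trans eta_gt0 (le_trans h1 h2).
apply: (ger_cvgy (f := fun n => K2^-1 * (n%:R * I n))).
  apply: filterS positive => n n0.
  have /andP[b1 b2] := J2_bounds n0.
  rewrite -lamE// mulrC ler_pdivrMr// ler_wpM2l// ltW//; exact: lam_gt0.
by apply: pinfty_scale => //; rewrite invr_gt0.
Qed.

Let s_pinfty : s n @[n --> \oo] --> +oo := pinfty_sqrt lam_pinfty.

Let sE n : (0 < n)%N -> s n ^+ 2 = lam n.
Proof. by move=> n0; rewrite sqr_sqrtr// ltW// lam_gt0. Qed.

Let T n := lam n * r n.
Let delta n := (s n)^-1 * eta * r n.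

(** Eventually [lam <= 2 * l / eta], while [r <= exp (- c * l)]: the power decay of [r] outweighs
    the growth of [T / r = lam]. *)
Let T_cvg0 : T n @[n --> \oo] --> (0 : R).
Proof.
have h : \forall n \near \oo, n%:R * I n / l n <= 2 by apply: (cvgr_le _ nI_div_l); lra.
apply: (@squeeze_cvgr _ _ _ _ (fun=> 0) (fun n => 2 / eta * (l n ^+ 1 * expR (- (c * l n))))).
- near=> n; have n0 : (0 < n)%N by near: n; exact: positive.
  have n0' : 0 < n%:R :> R by rewrite ltr0n.
  have l1 : 1 <= l n by near: n; exact: ((cvgryPge _).1 l_pinfty 1).
  have l0 := lt_le_trans ltr01 l1.
  have hn : n%:R * I n / l n <= 2 by near: n.
  have rn : r n <= n%:R `^ (- c) by near: n.
  have -> : expR (- (c * l n)) = n%:R `^ (- c).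
    by rewrite /powR gt_eqF// -/(l n) mulNr.
  have r0 := r_gt0 n0; have lm0 := lam_gt0 n0.
  rewrite /T mulr_ge0 ?(ltW lm0) ?(ltW r0)//= expr1 mulrA.
  apply: ler_pM => //; rewrite ?(ltW lm0) ?(ltW r0)//.
  have /andP[b1 b2] := J2_bounds n0.
  rewrite ler_pdivrMr// in hn.
  rewrite mulrAC ler_pdivlMr// (le_trans _ hn)// -lamE// ler_wpM2l ?(ltW lm0)//.
- exact: cvg_cst.
- rewrite -[X in _ --> X](mulr0 (2 / eta)); apply: cvgMr.
  exact: exp_decay_cvg0.
Unshelve. all: by end_near. Qed.

Let eps_cvg0 : (s n)^-1 @[n --> \oo] --> (0 : R) := pinfty_inv s_pinfty.

Let delta_le_T : \forall n \near \oo, 0 <= delta n <= T n.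
Proof.
near=> n; have n0 : (0 < n)%N by near: n; exact: positive.
have r0 := r_gt0 n0.
have s1 : 1 + eta <= s n by near: n; exact: ((cvgryPge _).1 s_pinfty (1 + eta)).
have s0 : 0 < s n by rewrite (lt_le_trans _ s1)// addr_gt0.
apply/andP; split; first by rewrite /delta !mulr_ge0 ?invr_ge0 ?(ltW s0) ?(ltW eta_gt0) ?(ltW r0).
rewrite /delta /T ler_pM2r// -sE// mulrC ler_pdivrMr//.
have s1' : 1 <= s n by have := eta_gt0; lra.
have : 1 <= s n ^+ 2 by rewrite exprn_ege1.
have := eta_gt0; nra.
Unshelve. all: by end_near. Qed.

Let delta_cvg0 : delta n @[n --> \oo] --> (0 : R).
Proof. by apply: squeeze_cvgr delta_le_T _ _ _; [exact: cvg_cst|exact: T_cvg0]. Qed.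

(** Inserting [nI = 4 * (L - ln L + G) + o] and [nI = lam * J2] gives the exact ratios
    [cr = (4 * L / nI) * exp (- o / 4)] and [er = (3 * L / l) ^ (3 / 2) * (4 * L / nI) ^ (1 / 2) *
    exp (- o / 2)]. After taking logarithms both identities are linear. *)
Let main_term (n : nat) : (0 < n)%N -> 1 <= l n -> 1 <= L n -> 0 < W n ->
  4 * expR (- (n%:R * (I n / 4))) / (n%:R * j n ^+ 2) = beta n * cr n /\
  2 * expR (- (2 * (n%:R * (I n / 4)))) / j n = X n * beta n ^+ 2 * er n.
Proof.
move=> n0 l1 L1 W0.
have n0' : 0 < n%:R :> R by rewrite ltr0n.
have l0 := lt_le_trans ltr01 l1; have L0 := lt_le_trans ltr01 L1.
have [J10 J20 j0] := J_gt0 n0; have [b0 _] := beta_eq n0.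
have p0 := p_gt0 n0; have r0 := r_gt0 n0.
have Lp : L n = - ln (p n) by rewrite /L div1r lnV// posrE.
have GE : G n = ln (J2 n) - (ln (beta n) + 2 * ln (J1 n)).
  rewrite /G ln_div ?posrE ?mulr_gt0 ?exprn_gt0// lnM ?posrE ?exprn_gt0// lnXn//.
  by rewrite mulr_natl.
have lnI : ln (n%:R * I n) = l n + ln (p n) + 2 * ln (r n) + ln (J2 n).
  rewrite -lamE// lnM ?posrE ?lam_gt0// /lam lnM ?posrE ?mulr_gt0 ?exprn_gt0//.
  rewrite lnM ?posrE// lnXn// mulr_natl.
  by rewrite -/(l n); ring.
have lnj : ln (j n) = ln (p n) + ln (r n) + ln (J1 n).
  by rewrite /j !lnM ?posrE ?mulr_gt0.
have oE : n%:R * I n = 4 * (L n - ln (L n) + G n) + o n by rewrite /o; ring.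
have ln4 : ln 4 = 2 * ln 2 :> R.
  by rewrite (_ : 4 = 2 ^+ 2); [rewrite lnXn// mulr_natl|rewrite -natrX].
have X0' : 0 < X n by rewrite /X mulr_gt0 ?powR_gt0// mulr_gt0 ?exprn_gt0 ?powR_gt0// mulr_gt0.
have lM (x y : R) : 0 < x -> 0 < y -> ln (x * y) = ln x + ln y.
  by move=> x0 y0; rewrite lnM ?posrE.
have lnX : ln (X n) = - (3 / 2) * (ln 3 + ln (J2 n)) + 3 * ln (J1 n) + 3 / 2 * ln (W n).
  have A0 : 0 < 3 * J2 n by rewrite mulr_gt0.
  have A1 : 0 < (3 * J2 n) `^ (- (3 / 2)) by rewrite powR_gt0.
  have A2 : 0 < J1 n ^+ 3 by rewrite exprn_gt0.
  have A3 : 0 < W n `^ (3 / 2) by rewrite powR_gt0.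
  rewrite /X (lM _ _ (mulr_gt0 A1 A2) A3) (lM _ _ A1 A2) (ln_powR (3 * J2 n)) (ln_powR (W n)).
  have l1' : ln (3 * J2 n) = ln 3 + ln (J2 n) by apply: lM.
  have l2' : ln (J1 n ^+ 3) = 3 * ln (J1 n) by rewrite lnXn// mulr_natl.
  by rewrite l1' l2'.
have Wl := lnW n0 l1.
have E (x y : R) : 0 < x -> ln x = y -> x = expR y by move=> x0 <-; rewrite lnK// posrE.
split.
- have e1 : beta n * cr n = expR (ln (beta n) + (- (ln (n%:R * I n) - ln (L n) - ln 4) - o n / 4)).
    by rewrite expRD lnK ?posrE.
  rewrite e1; apply: E.
    by rewrite divr_gt0 ?mulr_gt0 ?expR_gt0 ?exprn_gt0.
  rewrite ln_div ?posrE ?mulr_gt0 ?expR_gt0 ?exprn_gt0//.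
  rewrite (lM 4) ?expR_gt0// (lM n%:R) ?exprn_gt0//.
  rewrite expRK lnXn// mulr2n lnj lnI mulrA oE GE -/(l n) Lp; lra.
- have e2 : X n * beta n ^+ 2 * er n = expR (ln (X n) + 2 * ln (beta n) +
      (3 / 2 * (ln (L n) - ln (l n) + ln 3)
       - 1 / 2 * (ln (n%:R * I n) - ln (L n) - ln 4) - o n / 2)).
    by rewrite expRD; congr (_ * _); rewrite expRD lnK ?posrE// expRM_natl lnK ?posrE.
  rewrite e2; apply: E.
    by rewrite divr_gt0 ?mulr_gt0 ?expR_gt0 ?exprn_gt0.
  rewrite ln_div ?posrE ?mulr_gt0 ?expR_gt0 ?exprn_gt0// (lM 2) ?expR_gt0//.
  have nI2 : 2 * (n%:R * (I n / 4)) = n%:R * I n / 2 by field.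
  rewrite expRK lnj lnX Wl lnI nI2 oE GE ln4 Lp; lra.
Qed.

Let decay_cvg0 : 2 * K1 ^+ 2 * (s n ^+ 8 * expR (- (eta ^+ 2 / 2 * s n))) @[n --> \oo] --> (0 : R).
Proof.
rewrite -[X in _ --> X](mulr0 (2 * K1 ^+ 2)); apply: cvgMr.
by apply: exp_decay_cvg0 => //; rewrite divr_gt0 ?exprn_gt0.
Qed.

Let edge_cvg0 : expR (- (eta ^+ 2 * s n)) @[n --> \oo] --> (0 : R).
Proof. by apply: expRN_cvg0; apply: pinfty_scale => //; rewrite exprn_gt0. Qed.

Let interior_cvg0 : n%:R * expR (- (4 * (n%:R * (I n / 4)))) @[n --> \oo] --> (0 : R).
Proof.
(* Any constant strictly between 1 and the limit [4 / 3] would do; this one leaves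
   [n * exp (- nI) <= exp (- l / 6)]. *)
have h : \forall n \near \oo, 7 / 6 <= n%:R * I n / l n.
  by apply: (cvgr_ge _ nI_div_l); lra.
apply: (@squeeze_cvgr _ _ _ _ (fun=> 0) (fun n => expR (- (1 / 6 * l n)))).
- near=> n; have n0 : (0 < n)%N by near: n; exact: positive.
  have n0' : 0 < n%:R :> R by rewrite ltr0n.
  have l1 : 1 <= l n by near: n; exact: ((cvgryPge _).1 l_pinfty 1).
  have l0 := lt_le_trans ltr01 l1.
  have hn : 7 / 6 <= n%:R * I n / l n by near: n.
  rewrite ler_pdivlMr// in hn.
  rewrite mulr_ge0 ?expR_ge0 ?(ltW n0')//= -{1}[n%:R](lnK (n0' : n%:R \is Num.pos)) -/(l n).
  by rewrite -expRD ler_expR; lra.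
- exact: cvg_cst.
- by apply: expRN_cvg0; apply: pinfty_scale => //; lra.
Unshelve. all: by end_near. Qed.

(** Since [T / r = lam], the loss [n * tau] is a constant times [lam / (1 + lam) ^+ 2]. *)
Let tail_cvg0 : 8 * (n%:R * tau n (T n)) @[n --> \oo] --> (0 : R).
Proof.
have e : \forall n \near \oo, 8 * (n%:R * tau n (T n)) =
    8 * C * (pi / 2) ^+ 2 * (lam n * (1 + lam n) ^- 2).
  apply: filterS positive => n n0; have r0 := r_gt0 n0.
  rewrite /tau /T mulfK ?gt_eqF// /lam.
  by move: ((1 + _) ^- 2) => w; ring.
apply: (cvg_near_eq e); rewrite -[X in _ --> X](mulr0 (8 * C * (pi / 2) ^+ 2)); apply: cvgMr.
apply: (@squeeze_cvgr _ _ _ _ (fun=> 0) (fun n => (lam n)^-1)); last 2 first.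
- exact: cvg_cst.
- exact: pinfty_inv.
apply: filterS positive => n n0; have l0 := lam_gt0 n0.
have l1 : 0 < (1 + lam n) ^+ 2 by rewrite exprn_gt0// addr_gt0.
rewrite divr_ge0 ?(ltW l0) ?(ltW l1)//= ler_pdivrMr// mulrC ler_pdivlMr//; nra.
Qed.

(** [h1] and [h2] are the third and fourth terms inside [upper], multiplied by [n] and measured
    against the corner and edge contributions of [main_term]. *)
Let h1 n := (n%:R * j n * T n) ^+ 2 * expR (- (n%:R * ((1 - (s n)^-1) * j n) * delta n)).
Let h2 n := 2 * (n%:R * j n * T n) * expR (- (2 * (n%:R * ((1 - (s n)^-1) * j n) * delta n))).

Let nearly : \forall n \near \oo, [/\ [/\ (0 < n)%N, 1 <= l n, 1 <= L n & 0 < W n],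
  2 <= s n & T n <= 1 / 2 ].
Proof.
near=> n; split; [split|..].
- by near: n; exact: positive.
- by near: n; exact: ((cvgryPge _).1 l_pinfty 1).
- by near: n; exact: ((cvgryPge _).1 L_pinfty 1).
- have [_ _ /andP[W1 _]] : [/\ (0 < n)%N, 1 <= l n & c1 <= W n <= c2] by near: n.
  exact: lt_le_trans W1.
- by near: n; exact: ((cvgryPge _).1 s_pinfty 2).
- by near: n; apply: (cvgr_le _ T_cvg0); lra.
Unshelve. all: by end_near. Qed.

(** The power [s ^+ 8] arises from [n * j * T = J1 * lam ^+ 2 = J1 * s ^+ 4]. The exponent is
    [(s - 1) * (J1 * eta)], at least [eta ^+ 2 / 2 * s] once [s >= 2]. *)
Let h_bounds : \forall n \near \oo,
  (0 <= h1 n <= 2 * K1 ^+ 2 * (s n ^+ 8 * expR (- (eta ^+ 2 / 2 * s n)))) /\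
  (0 <= h2 n <= 2 * (1 + K1 ^+ 2) * (s n ^+ 8 * expR (- (eta ^+ 2 / 2 * s n)))).
Proof.
apply: filterS nearly => n [[n0 l1 L1 W0] s2 T2].
have [J10 J20 j0] := J_gt0 n0; have /andP[a1 a2] := J1_bounds n0.
have n0' : 0 < n%:R :> R by rewrite ltr0n.
have s0 : 0 < s n by apply: lt_le_trans s2.
have r0 := r_gt0 n0; have p0 := p_gt0 n0.
have sl := sE n0.
have jT : n%:R * j n * T n = J1 n * s n ^+ 4.
  rewrite (_ : s n ^+ 4 = (s n ^+ 2) ^+ 2); last by rewrite -exprM.
  by rewrite sl /T /j /lam; ring.
have kd : n%:R * ((1 - (s n)^-1) * j n) * delta n = (s n - 1) * (J1 n * eta).
  rewrite (_ : n%:R * ((1 - (s n)^-1) * j n) * delta n =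
    (1 - (s n)^-1) * (J1 n * eta) * (s n)^-1 * lam n); last first.
    by rewrite /delta /j /lam; ring.
  by rewrite -sl; field; rewrite gt_eqF.
have kde : eta ^+ 2 / 2 * s n <= (s n - 1) * (J1 n * eta).
  have h : eta ^+ 2 <= J1 n * eta by rewrite expr2 ler_pM2r.
  apply: (@le_trans _ _ (s n / 2 * (J1 n * eta))).
    rewrite (_ : eta ^+ 2 / 2 * s n = s n / 2 * eta ^+ 2); last by ring.
    by rewrite ler_wpM2l// divr_ge0// ltW.
  by rewrite ler_wpM2r ?mulr_ge0 ?(ltW J10) ?(ltW eta_gt0)//; lra.
rewrite /h1 /h2 jT kd.
set x := expR (- (eta ^+ 2 / 2 * s n)).
have x0 : 0 < x := expR_gt0 _.
have e1 : expR (- ((s n - 1) * (J1 n * eta))) <= x by rewrite ler_expR lerN2.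
have e2 : expR (- (2 * ((s n - 1) * (J1 n * eta)))) <= x.
  rewrite ler_expR lerN2 (le_trans kde)//.
  have : 0 <= (s n - 1) * (J1 n * eta).
    by rewrite mulr_ge0 ?mulr_ge0 ?(ltW J10) ?(ltW eta_gt0)//; lra.
  lra.
have J12 : J1 n ^+ 2 <= K1 ^+ 2.
  by rewrite ler_pXn2r// nnegrE ?(ltW J10)// (le_trans _ a2)// ltW.
have s8 : s n ^+ 4 <= s n ^+ 8 by rewrite ler_weXn2l//; lra.
have s40 : 0 <= s n ^+ 4 by rewrite exprn_ge0// ltW.
have s80 : 0 <= s n ^+ 8 by rewrite exprn_ge0// ltW.
have x0' := ltW x0; have J10' := ltW J10.
rewrite (_ : (J1 n * s n ^+ 4) ^+ 2 = J1 n ^+ 2 * s n ^+ 8); last by rewrite exprMn -exprM.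
move: (s n ^+ 4) (s n ^+ 8) s40 s80 s8 => S4 S8 S40 S80 S48.
have Sx : 0 <= S8 * x by rewrite mulr_ge0.
split; apply/andP; split.
- by rewrite mulr_ge0 ?expR_ge0 ?mulr_ge0 ?sqr_ge0.
- apply: (@le_trans _ _ (J1 n ^+ 2 * (S8 * x))).
    by rewrite -mulrA ler_wpM2l ?sqr_ge0// ler_wpM2l.
  by rewrite ler_wpM2r//; have := sqr_ge0 K1; lra.
- by rewrite mulr_ge0 ?expR_ge0// !mulr_ge0.
- apply: (@le_trans _ _ (2 * J1 n * (S8 * x))).
    rewrite mulrA -!mulrA ler_wpM2l// ler_wpM2l//.
    by apply: ler_pM; rewrite ?expR_ge0.
  rewrite ler_wpM2r// ler_wpM2l//.
  have := sqr_ge0 (J1 n - 1); nra.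
Qed.

Let h1_cvg0 : h1 n @[n --> \oo] --> (0 : R).
Proof.
apply: (@squeeze_cvgr _ _ _ _ (fun=> 0) _ _ _ _ (cvg_cst _) decay_cvg0).
by apply: filterS h_bounds => n [].
Qed.

Let h2_cvg0 : h2 n @[n --> \oo] --> (0 : R).
Proof.
have h : 2 * (1 + K1 ^+ 2) * (s n ^+ 8 * expR (- (eta ^+ 2 / 2 * s n))) @[n --> \oo] --> (0 : R).
  rewrite -[X in _ --> X](mulr0 (2 * (1 + K1 ^+ 2))); apply: cvgMr.
  by apply: exp_decay_cvg0 => //; rewrite divr_gt0 ?exprn_gt0.
apply: (@squeeze_cvgr _ _ _ _ (fun=> 0) _ _ _ _ (cvg_cst _) h).
by apply: filterS h_bounds => n [].
Qed.

Let upper_cvg : n%:R * upper n (s n)^-1 (T n) @[n --> \oo] --> alpha.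
Proof.
have e : \forall n \near \oo, n%:R * upper n (s n)^-1 (T n) =
  expR (8 * (n%:R * tau n (T n))) *
   ((beta n * (cr n * (((1 - (s n)^-1) ^+ 2)^-1 + h1 n)) +
     X n * beta n ^+ 2 * (er n * ((1 - (s n)^-1)^-1 + h2 n))) +
    n%:R * expR (- (4 * (n%:R * (I n / 4))))).
  apply: filterS nearly => n [[n0 l1 L1 W0] s2 T2].
  have [m1 m2] := main_term n0 l1 L1 W0.
  have [J10 J20 j0] := J_gt0 n0.
  have n0' : 0 < n%:R :> R by rewrite ltr0n.
  have s1 : 0 < 1 - (s n)^-1.
    by rewrite subr_gt0 invf_lt1//; lra.
  rewrite [beta n * _]mulrA -m1 [X n * beta n ^+ 2 * _]mulrA -m2 /upper /h1 /h2 -/(delta n).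
  move: (expR (8 * _)) (expR (- (n%:R * (I n / 4)))) => E8 E1.
  move: (expR (- (2 * (n%:R * (I n / 4))))) (expR (- (4 * (n%:R * (I n / 4))))) => E2 E4.
  move: (expR (- (2 * _))) (expR (- (_ * delta n))) => U2 U1.
  move: (1 - (s n)^-1) s1 => w w0.
  by field; rewrite !gt_eqF.
apply: (cvg_near_eq e); rewrite -[X in _ --> X]mul1r; apply: cvgM.
  by rewrite -[X in _ --> X]expR0; exact: (cvg_expR tail_cvg0).
rewrite -[X in _ --> X]addr0; apply: cvgD; last exact: interior_cvg0.
have w1 : 1 - (s n)^-1 @[n --> \oo] --> (1 : R).
  by rewrite -[X in _ --> X]subr0; apply: cvgB => //; exact: cvg_cst.
apply: cvg_convex_mix; first exact: weights.
- rewrite -[X in _ --> X]mulr1; apply: cvgM => //.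
  rewrite -[X in _ --> X]addr0; apply: cvgD => //.
  rewrite -[X in _ --> X]invr1; apply: cvgV; first exact: oner_neq0.
  by rewrite -[X in _ --> X](expr1n _ 2); apply: cvg_sqr.
- rewrite -[X in _ --> X]mulr1; apply: cvgM => //.
  rewrite -[X in _ --> X]addr0; apply: cvgD => //.
  by rewrite -[X in _ --> X]invr1; apply: cvgV; first exact: oner_neq0.
Qed.

(** [g1] and [g2] are the defects from truncating the exponential integrals of the lower bound at
    [delta]. *)
Let g1 n := expR (- (n%:R * ((1 + (s n)^-1) * j n) * delta n)).
Let g2 n := expR (- (2 * (n%:R * j n) * delta n)).

Let g_bounds : \forall n \near \oo,
  (0 <= g1 n <= expR (- (eta ^+ 2 * s n))) /\ (0 <= g2 n <= expR (- (eta ^+ 2 * s n))).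
Proof.
apply: filterS nearly => n [[n0 l1 L1 W0] s2 T2].
have [J10 J20 j0] := J_gt0 n0; have /andP[a1 a2] := J1_bounds n0.
have s0 : 0 < s n by apply: lt_le_trans s2.
have sl := sE n0.
have kd : n%:R * j n * delta n = s n * (J1 n * eta).
  rewrite (_ : n%:R * j n * delta n = (J1 n * eta) * (s n)^-1 * lam n); last first.
    by rewrite /delta /j /lam; ring.
  by rewrite -sl; field; rewrite gt_eqF.
have h : eta ^+ 2 * s n <= s n * (J1 n * eta).
  by rewrite mulrC ler_wpM2l ?(ltW s0)// expr2 ler_pM2r.
have h0 : 0 <= eta ^+ 2 * s n by rewrite mulr_ge0 ?sqr_ge0 ?(ltW s0).
rewrite /g1 /g2 !expR_ge0 /= !ler_expR !lerN2.
rewrite (_ : 2 * (n%:R * j n) * delta n = 2 * (n%:R * j n * delta n)); last by ring.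
rewrite (_ : n%:R * ((1 + (s n)^-1) * j n) * delta n =
  (1 + (s n)^-1) * (n%:R * j n * delta n)); last by ring.
rewrite kd; split; last lra.
by apply: (le_trans h); rewrite ler_peMl ?(le_trans h0 h)// lerDl invr_ge0 ltW.
Qed.

Let lower_cvg : n%:R * lower n (s n)^-1 @[n --> \oo] --> alpha.
Proof.
have g10 : g1 n @[n --> \oo] --> (0 : R).
  apply: (@squeeze_cvgr _ _ _ _ (fun=> 0) _ _ _ _ (cvg_cst _) edge_cvg0).
  by apply: filterS g_bounds => n [].
have g20 : g2 n @[n --> \oo] --> (0 : R).
  apply: (@squeeze_cvgr _ _ _ _ (fun=> 0) _ _ _ _ (cvg_cst _) edge_cvg0).
  by apply: filterS g_bounds => n [].
have e : \forall n \near \oo, n%:R * lower n (s n)^-1 =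
   beta n * (cr n * ((1 - g1 n) * (1 + (s n)^-1)^-1) ^+ 2) +
     X n * beta n ^+ 2 * (er n * ((1 - g2 n) * (1 - 2 * delta n))).
  apply: filterS nearly => n [[n0 l1 L1 W0] s2 T2].
  have [m1 m2] := main_term n0 l1 L1 W0.
  have [J10 J20 j0] := J_gt0 n0.
  have n0' : 0 < n%:R :> R by rewrite ltr0n.
  have s0 : 0 < s n by apply: lt_le_trans s2.
  have s1 : 0 < 1 + (s n)^-1 by rewrite addr_gt0// invr_gt0.
  rewrite [beta n * _]mulrA -m1 [X n * beta n ^+ 2 * _]mulrA -m2 /lower -/(delta n).
  rewrite -/(g1 n) -/(g2 n).
  move: (expR (- (n%:R * (I n / 4)))) (expR (- (2 * (n%:R * (I n / 4))))) => E1 E2.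
  move: (g1 n) (g2 n) (delta n) => U1 U2 d.
  move: (1 + (s n)^-1) s1 => w w0.
  by field; rewrite !gt_eqF.
apply: (cvg_near_eq e).
apply: cvg_convex_mix; first exact: weights.
- rewrite -[X in _ --> X]mulr1; apply: cvgM => //.
  rewrite -[X in _ --> X](expr1n _ 2); apply: cvg_sqr.
  rewrite -[X in _ --> X]mulr1; apply: cvgM.
    by rewrite -[X in _ --> X]subr0; apply: cvgB => //; exact: cvg_cst.
  rewrite -[X in _ --> X]invr1; apply: cvgV; first exact: oner_neq0.
  by rewrite -[X in _ --> X]addr0; apply: cvgD => //; exact: cvg_cst.
- rewrite -[X in _ --> X]mulr1; apply: cvgM => //.
  rewrite -[X in _ --> X]mulr1; apply: cvgM.
    by rewrite -[X in _ --> X]subr0; apply: cvgB => //; exact: cvg_cst.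
  rewrite -[X in _ --> X]subr0; apply: cvgB; first exact: cvg_cst.
  by rewrite -[X in _ --> X](mulr0 2); exact: cvgMr.
Qed.

Lemma bounded_integral_cvg : n%:R * F n @[n --> \oo] --> alpha.
Proof.
apply: squeeze_cvgr lower_cvg upper_cvg.
near=> n.
have [[n0 _ _ _] s2 T2] : [/\ [/\ (0 < n)%N, 1 <= l n, 1 <= L n & 0 < W n],
  2 <= s n & T n <= 1 / 2 ] by near: n.
have /andP[_ dT] : 0 <= delta n <= T n by near: n.
have s0 : 0 < s n by apply: lt_le_trans s2.
have [h h'] : lower n (s n)^-1 <= F n /\ F n <= upper n (s n)^-1 (T n).
  by apply: F_bounds => //; rewrite ?invr_gt0// invf_lt1//; lra.
by rewrite !ler_wpM2l.
Unshelve. all: by end_near. Qed.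

End isolated_vertices_asymptotics.

Theorem theorem8p2 (R : realType) (alpha eta : R)
    (phi : nat -> R * R -> R) (p r beta : nat -> R)
    (alpha_gt0 : 0 < alpha) (eta_gt0 : 0 < eta) (eta_le1 : eta <= 1)
    (phi_class : forall n, (0 < n)%N -> Phi2 eta (phi n) /\ Psi2 (phi n))
    (pE : forall n, p n = conn_mu (phi n))
    (rE : forall n, r n = conn_rho eta (phi n))
    (r_small : npow_neg_Omega1 r)
    (p_Theta : is_Theta p (fun n => n%:R `^ (- (1 / 3)) * (ln n%:R)^-1))
    (beta_sol : forall n, (0 < n)%N -> 0 < beta n /\
       (3 * conn_J2 eta (phi n)) `^ (- (3 / 2)) * conn_J1 eta (phi n) ^+ 3 *
       (n%:R `^ (1 / 3) * p n * ln n%:R) `^ (3 / 2) * beta n ^+ 2 + beta n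
       = alpha)
    (nI_asymp :
       (fun n => n%:R * conn_I (phi n) -
          4 * (ln (1 / p n) - ln (ln (1 / p n)) +
               ln (conn_J2 eta (phi n) /
                   (beta n * conn_J1 eta (phi n) ^+ 2)))) @ \oo --> (0 : R)) :
  (fun n => n%:R * \int[@leb2 R]_(x in @unit_square R)
     expR (- (n%:R * \int[@leb2 R]_(y in @unit_square R) phi n (y - x))))
    @ \oo --> alpha.
Proof.
(* [C] is fixed before [n], which makes the bounds on [J1] and [J2] uniform along the sequence. *)
have [C C0 C_decay] := stretched_exp_le_polynomial eta_gt0.
have [c c0 r_le] := r_small.
have [c1 [c2 [c10 c20 p_bounds]]] := p_Theta.
pose F n := \int[@leb2 R]_(x in @unit_square R)
  expR (- (n%:R * \int[@leb2 R]_(y in @unit_square R) phi n (y - x))).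
apply: (@bounded_integral_cvg R alpha eta C (C * (pi / 2)) (4 * C * (pi / 2) ^+ 2) c1 c2 c
  p r beta (fun n => conn_I (phi n)) (fun n => conn_J1 eta (phi n))
  (fun n => conn_J2 eta (phi n)) F) => //.
- by move=> n n0; have [h h'] := phi_class n n0; rewrite pE; exact: conn_mu_gt0 h h'.
- by move=> n n0; have [h h'] := phi_class n n0; rewrite rE; exact: conn_rho_gt0 h.
- move=> n n0; have [h h'] := phi_class n n0; rewrite pE rE; exact: conn_J2E h h' _ C0 C_decay.
- move=> n n0; have [h h'] := phi_class n n0; exact: conn_J1_bounds h h' _ C0 C_decay.
- move=> n n0; have [h h'] := phi_class n n0; exact: conn_J2_bounds h h' _ C0 C_decay.
move=> n eps T n0 eps0 eps1; have [h h'] := phi_class n n0; rewrite pE rE => dT T12.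
have n0' : 0 < n%:R :> R by rewrite ltr0n.
exact: (conn_integral_bounds eta_gt0 h h' C0 C_decay n0' eps0 eps1 dT T12).
Qed.
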